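(* Let $R(z)$ be a rational function (quotient of two polynomials) such that $R(z)=O(z^{-2})$ as $z\to\infty$ and such that $R$ has no poles at integers, except possibly at $0$. Then $$\sum_{k=1}^\infty R(k) H_k = \frac12\sum_{\alpha \text{ pole of } R}\operatorname{Res}\left[R'(s)\,(\psi(-s)+\gamma)-R(s)\,(\psi(-s)+\gamma)^2\right]_{s=\alpha},$$ where the sum on the right runs over the (distinct) poles $\alpha\in\mathbb C$ of $R$.
   Context: $H_k = 1+1/2+\cdots+1/k$ is the $k$th harmonic number. $\gamma=0.5772\ldots$ is Euler's constant. $\psi(z)=\Gamma'(z)/\Gamma(z)$ is the digamma function, meromorphic on $\mathbb C$ with simple poles exactly at the nonpositive integers. $\operatorname{Res}[Q(s)]_{s=\alpha}$ denotes the residue (in the sense of complex analysis) of the meromorphic function $Q(s)$ at $s=\alpha$. *)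

(* Defs.v *)
From HB Require Import structures.
From mathcomp Require Import all_boot all_order all_algebra.
From mathcomp Require Import all_classical all_reals all_analysis.
From mathcomp Require Import complex.

Set Implicit Arguments.
Unset Strict Implicit.
Unset Printing Implicit Defensive.

Import Order.TTheory GRing.Theory Num.Theory.
Import numFieldNormedType.Exports.

Local Open Scope classical_set_scope.
Local Open Scope complex_scope.
Local Open Scope ring_scope.

(* The complex numbers are R[i] for R : realType.  The type R[i]^o is R[i] as a
   normed space over itself: limits in it are for the topology of the modulus,
   and f^`() for f : R[i] -> R[i]^o is the complex derivative. *)

(* H_k; [harmonic] is the sequence n |-> 1 / (n + 1), and [series u k] is the
   sum of the first k terms of u. *)
Definition harmonic_number (K : fieldType) (k : nat) : K :=
  series (@harmonic K) k.

Definition euler_gamma (R : realType) : R :=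
  lim ((harmonic_number R n - ln n%:R) @[n --> \oo]).

Definition cexp (R : realType) (z : R[i]) : R[i] :=
  (expR (complex.Re z))%:C * (cos (complex.Im z) +i* sin (complex.Im z)).

(* n ^ z = exp (z log n), for n > 0. *)
Definition nat_cpow (R : realType) (n : nat) (z : R[i]) : R[i] :=
  cexp (z * (ln n%:R)%:C).

(* Euler's limit formula
     Gamma(z) = lim_n n! n^z / (z (z + 1) ... (z + n)),
   which defines Gamma on the whole complex plane minus the nonpositive
   integers.  At a nonpositive integer the value is junk (division by 0 is
   total), so Gamma and digamma are only meaningful off these points. *)
Definition Gamma (R : realType) (z : R[i]) : R[i]^o :=
  lim ((n`!%:R * nat_cpow n z / \prod_(0 <= k < n.+1) (z + k%:R) : R[i]^o)
         @[n --> \oo]).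

Definition digamma (R : realType) (z : R[i]) : R[i] :=
  (@Gamma R)^`()%classic z / Gamma z.

(* [laurent f a c]: f is analytic or has at worst a pole at a, and
   f z = \sum_(n : int) c n (z - a) ^ n on a punctured disc around a.
   The principal part is finite, so the sum is a series starting at some -m. *)
Definition laurent (R : realType) (f : R[i] -> R[i]) (a : R[i])
    (c : int -> R[i]) : Prop :=
  exists m : nat,
    (forall n : int, n < - m%:Z -> c n = 0) /\
    exists2 r : R, 0 < r &
      forall z : R[i], 0 < `|z - a| -> `|z - a| < r%:C ->
        (\sum_(0 <= k < N) c (k%:Z - m%:Z) * (z - a) ^ (k%:Z - m%:Z)
           : R[i]^o) @[N --> \oo] --> (f z : R[i]^o).

(* The coefficient of (z - a) ^ -1 in the Laurent expansion of f at a; it is 0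
   by convention if f is not meromorphic at a. *)
Definition residue (R : realType) (f : R[i] -> R[i]) (a : R[i]) : R[i] :=
  xget 0 [set w | exists2 c : int -> R[i], laurent f a c & w = c (- 1)].

(* The rational function p / q is handled through its reduced fraction, so that
   its values at removable singularities of p / q are the right ones and its
   poles are exactly the zeros of the reduced denominator. *)
Definition ratfun_num (K : fieldType) (p q : {poly K}) : {poly K} :=
  p %/ gcdp p q.

Definition ratfun_den (K : fieldType) (p q : {poly K}) : {poly K} :=
  q %/ gcdp p q.

Definition ratfun (R : realType) (p q : {poly R[i]}) (z : R[i]) : R[i]^o :=
  (ratfun_num p q).[z] / (ratfun_den p q).[z].

Definition poles (R : realType) (p q : {poly R[i]}) : set R[i] :=
  [set a | root (ratfun_den p q) a].

(* Main.v *)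
Require Import Defs.
From HB Require Import structures.
From mathcomp Require Import all_boot all_order all_algebra.
From mathcomp Require Import all_classical all_reals all_analysis.
From mathcomp Require Import complex.
From mathcomp Require Import ring lra zify.

Set Implicit Arguments.
Unset Strict Implicit.
Unset Printing Implicit Defensive.

Import Order.TTheory GRing.Theory Num.Theory.
Import numFieldNormedType.Exports.

Local Open Scope classical_set_scope.
Local Open Scope complex_scope.
Local Open Scope ring_scope.

(* Let phi_N(s) = H_N - sum_(n <= N) 1/(n - s), which tends to
   phi(s) = psi(-s) + gamma, and let H_n be the harmonic numbers.  Expanding
   the square by partial fractions gives the exact identity
     phi_N^2 + phi_N' = H_N^2 - 2 sum_(1 <= n <= N) w_(N,n) / (n - s),
   with w_(N,n) = H_n + (H_N - H_(N-n)).  As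
   R' phi - R phi^2 = (R phi)' - R (phi^2 + phi'), its residue at a pole a of R
   is minus that of R (phi^2 + phi'), hence the limit of minus the residue of
   R (phi_N^2 + phi_N').  Write R = sum c_t / (z - b_t)^(j_t + 1): no polynomial
   part occurs, and sum_(j_t = 0) c_t = 0, because R = O(z^-2).  The residues of
   the finite expressions then add up to 2 sum_(1 <= n <= N) w_(N,n) R(n), since
   the H_N^2 terms cancel.  Finally
   sum_(1 <= n <= N) R(n) (H_N - H_(N-n)) = O(H_N / N) tends to 0. *)

(** * Taylor expansions and residues *)

(** No contour integral is used: residues are Taylor coefficients of (z - a)^m f. The delicate point
    is the passage to the limit. In H_N^2 - 2 sum w_(N,n) / (n - s) both parts diverge, so
    convergence is read off the other expression: the residue of R' phi_N - R phi_N^2 is a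
    polynomial in finitely many Taylor coefficients of (z - a) phi_N, and each of these converges.
    The derivative of phi_N is taken at finite N only. The identity for phi_N^2 + phi_N' also
    removes the pole at 0, so that a = 0 is treated like every other pole of R. The digamma function
    is reached in the same spirit. Gamma(z + h) / Gamma(z) is an infinite product of factors 1 + h
    t_k + O(h^2 / k^2) with t_k = O(k^-2); a bound of second order in h, uniform in the number of
    factors, passes to the limit and differentiates Gamma. *)

Lemma near_dnbhs_norm (K : numFieldType) (a e : K) : 0 < e ->
  \forall z \near a^', z != a /\ `|z - a| < e.
Proof.
by move=> e0; exists e => //= z; rewrite /ball /= distrC.
Qed.

Lemma dnbhs_normP (K : numFieldType) (a : K) (P : K -> Prop) :
  (\forall z \near a^', P z) ->
  exists2 e : K, 0 < e & forall z, z != a -> `|z - a| < e -> P z.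
Proof.
move=> [e /= e0 He]; exists e => // z zna ze.
by apply: He => //=; rewrite distrC.
Qed.

Lemma dnbhs_ex (K : numFieldType) (a e : K) (P : K -> Prop) : 0 < e ->
  (\forall z \near a^', P z) -> exists z, [/\ P z, z != a & `|z - a| < e].
Proof.
move=> e0 HP; suff /(@filter_ex _ a^')[z [? []]] :
  \forall z \near a^', P z /\ (z != a /\ `|z - a| < e) by exists z.
exact: filterI HP (near_dnbhs_norm a e0).
Qed.

(* A Taylor expansion of [f] at [a] through its remainders: a geometric bound,
   uniform in [N], on a punctured neighbourhood.  In this form expansions pass
   to products and to pointwise limits, and the value at [a] plays no role. *)
Definition taylor (K : numFieldType) (f : K -> K) (a : K) (c : nat -> K) :=
  exists C rho : K, [/\ 0 <= C, 0 <= rho & \forall z \near a^', forall N,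
    `|f z - \sum_(k < N) c k * (z - a) ^+ k| <= C * (rho * `|z - a|) ^+ N].

Section Tay.
Variable K : numFieldType.
Implicit Types (f g : K -> K) (a b z : K) (c d : nat -> K).

Lemma taylor_eq f g a c : (\forall z \near a^', f z = g z) ->
  taylor f a c -> taylor g a c.
Proof.
move=> fg [C [rho [C0 r0 H]]]; exists C, rho; split=> //.
by near=> z => N; rewrite -(near fg z) //; apply: (near H z).
Unshelve. all: by end_near. Qed.

Lemma taylor_coef f a c d : c =1 d -> taylor f a c -> taylor f a d.
Proof. by move=> /funext ->. Qed.

Lemma le_geom (C C' r r' : K) N : 0 <= C -> 0 <= r -> C <= C' -> r <= r' ->
  C * r ^+ N <= C' * r' ^+ N.
Proof.
move=> C0 r0 CC rr; apply: ler_pM => //; first exact: exprn_ge0.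
by apply: lerXn2r => //; rewrite nnegrE //; apply: le_trans rr.
Qed.

Lemma taylor_common f g a c d : taylor f a c -> taylor g a d ->
  exists C rho : K, [/\ 0 <= C, 0 <= rho & \forall z \near a^', forall N,
    `|f z - \sum_(k < N) c k * (z - a) ^+ k| <= C * (rho * `|z - a|) ^+ N /\
    `|g z - \sum_(k < N) d k * (z - a) ^+ k| <= C * (rho * `|z - a|) ^+ N].
Proof.
move=> [C [r [C0 r0 H]]] [C' [r' [C'0 r'0 H']]].
exists (C + C'), (r + r'); split; rewrite ?addr_ge0 //.
near=> z => N; split.
  apply: le_trans ((near H z _) N) _ => //; apply: le_geom => //.
  - by rewrite mulr_ge0.
  - by rewrite lerDl.
  - by rewrite ler_wpM2r ?lerDl.
apply: le_trans ((near H' z _) N) _ => //; apply: le_geom => //.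
- by rewrite mulr_ge0.
- by rewrite lerDr.
- by rewrite ler_wpM2r ?lerDr.
Unshelve. all: by end_near. Qed.

Lemma taylorD f g a c d : taylor f a c -> taylor g a d ->
  taylor (fun z => f z + g z) a (fun k => c k + d k).
Proof.
move=> /taylor_common /[apply] -[C [r [C0 r0 H]]].
exists (C + C), r; split; rewrite ?addr_ge0 //.
near=> z => N; have [|H1 H2] := near H z _ N => //.
under eq_bigr do rewrite mulrDl; rewrite big_split /= opprD addrACA mulrDl.
by apply: le_trans (ler_normD _ _) _; exact: lerD.
Unshelve. all: by end_near. Qed.

Lemma taylorZ (w : K) f a c : taylor f a c ->
  taylor (fun z => w * f z) a (fun k => w * c k).
Proof.
move=> [C [r [C0 r0 H]]]; exists (`|w| * C), r; split; rewrite ?mulr_ge0 //.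
near=> z => N; under eq_bigr do rewrite -mulrA.
rewrite -mulr_sumr -mulrBr normrM -mulrA ler_wpM2l //.
exact: (near H z).
Unshelve. all: by end_near. Qed.

(** The term [c k * (z - a) ^+ k] is the difference of two consecutive remainders. At a point with
    [rho * |z - a| <= 1] the bound on the second is at most the bound on the first, whence
    [C + C]. *)
Lemma taylor_bound f a c : taylor f a c ->
  exists C rho : K, [/\ 0 <= C, 0 <= rho & forall k, `|c k| <= C * rho ^+ k].
Proof.
move=> [C [r [C0 r0 H]]]; exists (C + C), r; split; rewrite ?addr_ge0 // => k.
have e0 : 0 < (r + 1)^-1 by rewrite invr_gt0 ltr_wpDl.
have [z [Hz zna zr]] := dnbhs_ex e0 H.
have x0 : 0 < `|z - a| by rewrite normr_gt0 subr_eq0.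
rewrite -(ler_pM2r (exprn_gt0 k x0)) -normrX -normrM.
have -> : c k * (z - a) ^+ k =
  (f z - \sum_(k < k) c k * (z - a) ^+ k) -
  (f z - \sum_(k < k.+1) c k * (z - a) ^+ k).
  by rewrite big_ord_recr /=; ring.
apply: le_trans (ler_normB _ _) _; rewrite normrX -mulrA -exprMn mulrDl.
apply: lerD; first exact: Hz.
apply: le_trans (Hz _) _; rewrite ler_wpM2l // exprS.
rewrite ler_piMl ?exprn_ge0 ?mulr_ge0 //.
have r10 : 0 < r + 1 by rewrite ltr_wpDl.
rewrite -(ler_pM2l r10) mulrCA mulr1.
apply: (@le_trans _ _ (r * 1)); last by rewrite mulr1 lerDl.
by rewrite ler_wpM2l // -(ler_pM2l e0) mulr1 mulrA mulVf ?gt_eqF // mul1r ltW.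
Qed.

(** By strong induction the remainder of order [k.+1] is [c k * (z - a) ^+ k] alone, up to sign, so
    [|c k| <= C * r ^+ k.+1 * |z - a|] for [z] arbitrarily close to [a]. *)
Lemma taylor0_coef a c : taylor (fun=> 0) a c -> forall k, c k = 0.
Proof.
move=> [C [r [C0 r0 H]]].
elim/ltn_ind => k IH; apply/eqP; rewrite -normr_le0; apply/ler_addgt0Pr => eps eps0.
have M0 : 0 <= C * r ^+ k.+1 by rewrite mulr_ge0 ?exprn_ge0.
have M1 : 0 < C * r ^+ k.+1 + 1 by rewrite ltr_wpDl.
have e0 : 0 < eps / (C * r ^+ k.+1 + 1) by rewrite divr_gt0.
have [z [Hz zna zr]] := dnbhs_ex e0 H.
have x0 : 0 < `|z - a| by rewrite normr_gt0 subr_eq0.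
have := Hz k.+1; rewrite big_ord_recr big1 => [|i _]; last by rewrite /= IH ?mul0r.
rewrite /= !add0r normrN normrM normrX exprMn mulrA [X in _ <= _ * X]exprS mulrA.
rewrite ler_pM2r ?exprn_gt0 // => /le_trans; apply; rewrite mulrC.
apply: (@le_trans _ _ (eps / (C * r ^+ k.+1 + 1) * (C * r ^+ k.+1 + 1))).
  by apply: ler_pM => //; [exact: ltW|rewrite lerDl].
by rewrite divfK ?gt_eqF.
Qed.

Lemma taylor_uniq f a c d : taylor f a c -> taylor f a d -> c =1 d.
Proof.
move=> fc fd k; apply/eqP; rewrite -subr_eq0 -mulN1r; apply/eqP.
apply: (taylor0_coef (a := a) (c := fun k => c k + -1 * d k)).
apply: taylor_eq (taylorD fc (taylorZ (-1) fd)).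
by apply: nearW => z /=; rewrite mulN1r subrr.
Qed.

Definition cauchy_prod c d (k : nat) : K := \sum_(i < k.+1) c i * d (k - i)%N.

(** The product is truncated along the triangle i + j < N, so the second factor stops at [N - i];
    the error in [taylorM] is split along these rows. *)
Lemma cauchy_prod_sum c d x N : \sum_(k < N) cauchy_prod c d k * x ^+ k =
  \sum_(i < N) c i * x ^+ i * \sum_(j < N - i) d j * x ^+ j.
Proof.
elim: N => [|N IH]; first by rewrite !big_ord0.
rewrite big_ord_recr IH [RHS](eq_bigr (fun i : 'I_N.+1 => c i * x ^+ i *
   (\sum_(j < N - i) d j * x ^+ j) + c i * d (N - i)%N * x ^+ N)); last first.
  move=> [i /= iN] _; rewrite subSn // big_ord_recr mulrDr /=; congr (_ + _).
  by rewrite mulrACA -exprD subnKC.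
rewrite big_split /= [in RHS]big_ord_recr /= subnn big_ord0 mulr0 addr0.
by rewrite -mulr_suml.
Qed.

Lemma taylorM f g a c d : taylor f a c -> taylor g a d ->
  taylor (fun z => f z * g z) a (cauchy_prod c d).
Proof.
move=> fc gd; have [C1 [r1 [C10 r10 cB]]] := taylor_bound fc.
have [C2 [r2 [C20 r20 H]]] := taylor_common fc gd.
pose C := C1 + C2; pose r := r1 + r2.
have C0 : 0 <= C by rewrite addr_ge0.
have r0 : 0 <= r by rewrite addr_ge0.
(* There are [1 + N] error terms, each at most [C * C * (r * |z - a|) ^+ N]; their number is
   absorbed into the rate by [1 + N <= 3 ^ N]. *)
exists (C * C), (3 * r); split; rewrite ?mulr_ge0 //.
near=> z => N.
have HN n : `|f z - \sum_(k < n) c k * (z - a) ^+ k| <= C * (r * `|z - a|) ^+ n /\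
    `|g z - \sum_(k < n) d k * (z - a) ^+ k| <= C * (r * `|z - a|) ^+ n.
  have [|H1 H2] := near H z _ n => //.
  by split; [apply: le_trans H1 _|apply: le_trans H2 _];
    apply: le_geom; rewrite ?mulr_ge0 ?lerDr ?ler_wpM2r ?lerDr.
have cB' n : `|c n| <= C * r ^+ n.
  by apply: le_trans (cB n) _; apply: le_geom; rewrite ?lerDl.
rewrite cauchy_prod_sum; set x := z - a in HN *.
have -> : f z * g z - \sum_(i < N) c i * x ^+ i * \sum_(j < N - i) d j * x ^+ j
  = (f z - \sum_(k < N) c k * x ^+ k) * g z +
    \sum_(i < N) c i * x ^+ i * (g z - \sum_(j < N - i) d j * x ^+ j).
  under [X in _ = _ + X]eq_bigr do rewrite mulrBr.
  by rewrite sumrB -mulr_suml; ring.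
apply: le_trans (ler_normD _ _) _.
apply: (@le_trans _ _ (C * C * (r * `|x|) ^+ N * (1 + N%:R))).
  rewrite mulrDr mulr1; apply: lerD.
    have := (HN 0%N).2; rewrite big_ord0 subr0 expr0 mulr1 => gC.
    by rewrite normrM mulrAC; apply: ler_pM => //; exact: (HN N).1.
  apply: le_trans (ler_norm_sum _ _ _) _.
  have -> : N%:R = \sum_(i < N) (1 : K) by rewrite sumr_const card_ord.
  rewrite mulr_sumr; apply: ler_sum => -[i /= iN] _; rewrite mulr1 !normrM normrX.
  apply: (@le_trans _ _ ((C * r ^+ i * `|x| ^+ i) * (C * (r * `|x|) ^+ (N - i)))).
    by apply: ler_pM => //; [rewrite ler_wpM2r ?exprn_ge0|exact: (HN _).2].
  by rewrite -(mulrA C) -exprMn mulrACA -exprD subnKC // ltnW.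
rewrite -(mulrA 3) [in leRHS]exprMn (mulrC (3 ^+ N)) mulrA ler_wpM2l //.
  by rewrite !mulr_ge0 ?exprn_ge0 ?mulr_ge0.
rewrite -[1]/(1%:R) -natrD -natrX ler_nat add1n.
by elim: N {HN} => // N IH; rewrite expnS; lia.
Unshelve. all: by end_near. Qed.
End Tay.

Section TayExamples.
Variable K : numFieldType.
Implicit Types (f g : K -> K) (a b w z r : K) (c d : nat -> K).

Lemma geom_rem1 r N : r != 1 ->
  (1 - r)^-1 - \sum_(k < N) r ^+ k = r ^+ N / (1 - r).
Proof.
move=> r1; have r1' : 1 - r != 0 by rewrite subr_eq0 eq_sym.
elim: N => [|N IH]; first by rewrite big_ord0 subr0 expr0 mul1r.
rewrite big_ord_recr /= opprD addrA IH exprS; field.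
exact: r1'.
Qed.

Lemma geom_rem2 r N : r != 1 ->
  r / (1 - r) ^+ 2 - \sum_(k < N) k%:R * r ^+ k =
  r ^+ N * (N%:R / (1 - r) + r / (1 - r) ^+ 2).
Proof.
move=> r1; have r1' : 1 - r != 0 by rewrite subr_eq0 eq_sym.
elim: N => [|N IH]; first by rewrite big_ord0 subr0 expr0 mul0r mul1r add0r.
rewrite big_ord_recr /= opprD addrA IH (exprS r) -natr1; field.
exact: r1'.
Qed.

Lemma geom_half r : `|r| <= 2^-1 -> r != 1 /\ `|(1 - r)^-1| <= 2.
Proof.
move=> rh; have h : 2^-1 <= `|1 - r|.
  have := lerB_dist 1 r; rewrite normr1; apply: le_trans.
  rewrite lerBrDr -lerBrDl; have -> // : 1 - 2^-1 = 2^-1 :> K by field.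
split; first by apply: contraTneq h => ->; rewrite subrr normr0 invr_le0 lern0.
by rewrite normfV -[leRHS]invrK lef_pV2 // posrE ?invr_gt0 // (lt_le_trans _ h) ?invr_gt0.
Qed.

Lemma geom_bound1 r N : `|r| <= 2^-1 ->
  `|(1 - r)^-1 - \sum_(k < N) r ^+ k| <= 2 * `|r| ^+ N.
Proof.
move=> /geom_half[r1 h]; rewrite geom_rem1 // normrM normrX mulrC.
by rewrite ler_wpM2r // exprn_ge0.
Qed.

(** The exact remainder is at most [2 * N.+1] times [|r| ^+ N]; the inequality [N.+1 <= 2 ^ N]
    absorbs the linear factor by doubling the ratio. *)
Lemma geom_bound2 r N : `|r| <= 2^-1 ->
  `|r / (1 - r) ^+ 2 - \sum_(k < N) k%:R * r ^+ k| <= 2 * (2 * `|r|) ^+ N.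
Proof.
move=> rh; have [r1 h] := geom_half rh.
rewrite geom_rem2 // normrM normrX exprMn mulrA mulrC ler_wpM2r ?exprn_ge0 //.
apply: (@le_trans _ _ (2 * N.+1%:R)); last first.
  by rewrite ler_pM2l // -natrX ler_nat ltn_expl.
apply: le_trans (ler_normD _ _) _; rewrite -[N.+1%:R]natr1 mulrDr mulr1; apply: lerD.
  by rewrite normrM normr_nat mulrC ler_wpM2r.
rewrite normrM -exprVn normrX; apply: (@le_trans _ _ (2^-1 * 2 ^+ 2)).
  by apply: ler_pM; rewrite ?exprn_ge0 //; apply: lerXn2r; rewrite ?nnegrE.
by rewrite expr2 mulrA mulVf // mul1r.
Qed.

(* [g] stands for [(z - a) f'(z)].  For the Euler operator [(z - a) d/dz], the
   Leibniz rule on coefficients is just [k = i + (k - i)]. *)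
Definition euler_taylor f g a c := taylor f a c /\ taylor g a (fun k => k%:R * c k).

Lemma euler_taylor_M f f' g g' a c d : euler_taylor f f' a c -> euler_taylor g g' a d ->
  euler_taylor (fun z => f z * g z) (fun z => f' z * g z + f z * g' z)
    a (cauchy_prod c d).
Proof.
move=> [fc f'c] [gd g'd]; split; first exact: taylorM.
apply: taylor_coef (taylorD (taylorM f'c gd) (taylorM fc g'd)) => k.
rewrite /cauchy_prod mulr_sumr -big_split; apply: eq_bigr => -[i /= ik] _.
by rewrite natrB //; ring.
Qed.

Lemma euler_taylor_D f f' g g' a c d : euler_taylor f f' a c -> euler_taylor g g' a d ->
  euler_taylor (fun z => f z + g z) (fun z => f' z + g' z) a (fun k => c k + d k).
Proof.
move=> [fc f'c] [gd g'd]; split; first exact: taylorD.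
by apply: taylor_coef (taylorD f'c g'd) => k; rewrite mulrDr.
Qed.

Lemma euler_taylor_Z w f f' a c : euler_taylor f f' a c ->
  euler_taylor (fun z => w * f z) (fun z => w * f' z) a (fun k => w * c k).
Proof.
move=> [fc f'c]; split; first exact: taylorZ.
by apply: taylor_coef (taylorZ w f'c) => k; rewrite mulrCA.
Qed.

Lemma euler_taylor_eq f f1 g g1 a c : (\forall z \near a^', f z = g z) ->
  (\forall z \near a^', f1 z = g1 z) -> euler_taylor f f1 a c -> euler_taylor g g1 a c.
Proof. by move=> e e1 [H H1]; split; [exact: taylor_eq H|exact: taylor_eq H1]. Qed.

Lemma taylor_cst w a : taylor (fun=> w) a (fun k => w *+ (k == 0%N)).
Proof.
exists `|w|, 0; split=> //; apply: nearW => z [|N].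
  by rewrite big_ord0 subr0 expr0 mulr1.
rewrite big_ord_recl expr0 mulr1 big1 => [|i _]; last by rewrite mul0r.
by rewrite addr0 subrr normr0 mul0r expr0n mulr0.
Qed.

Lemma euler_taylor_cst w a : euler_taylor (fun=> w) (fun=> 0) a (fun k => w *+ (k == 0%N)).
Proof.
split; first exact: taylor_cst.
by apply: taylor_coef (taylor_cst 0 a) => -[|k]; rewrite ?mul0r ?mulr0n ?mulr0 ?mul0rn.
Qed.

Lemma taylor_x a : taylor (fun z => z - a) a (fun k => (k == 1%N)%:R).
Proof.
exists 1, 1; split=> //; near=> z.
have [|_ z1] := near (@near_dnbhs_norm _ a 1 ltr01) z => //.
move=> [|[|N]]; rewrite !mul1r.
- by rewrite big_ord0 subr0 expr0; exact: ltW.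
- by rewrite big_ord_recl big_ord0 mul0r addr0 subr0 expr1.
- rewrite 2!big_ord_recl mul0r add0r big1 => [|i _]; last by rewrite mul0r.
  by rewrite mul1r addr0 subrr normr0 exprn_ge0.
Unshelve. all: by end_near. Qed.

Lemma euler_taylor_x a :
  euler_taylor (fun z => z - a) (fun z => z - a) a (fun k => (k == 1%N)%:R).
Proof.
split; first exact: taylor_x.
by apply: taylor_coef (taylor_x a) => -[|[|k]]; rewrite ?mulr0 ?mulr1.
Qed.

Lemma inv_expand b z a : b != a -> z != b ->
  (b - z)^-1 = (b - a)^-1 / (1 - (z - a) / (b - a)) /\
  (z - a) / (b - z) ^+ 2 = (b - a)^-1 *
    ((z - a) / (b - a) / (1 - (z - a) / (b - a)) ^+ 2).
Proof.
move=> ba zb; have ba' : b - a != 0 by rewrite subr_eq0.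
have bz' : b - z != 0 by rewrite subr_eq0 eq_sym.
have -> : 1 - (z - a) / (b - a) = (b - z) / (b - a) by field.
by split; field; rewrite ba' bz'.
Qed.

Lemma inv_bound a b z N : b != a -> z != b -> `|(z - a) / (b - a)| <= 2^-1 ->
  `|(b - z)^-1 - \sum_(k < N) (b - a) ^- k.+1 * (z - a) ^+ k|
     <= 2 * `|b - a|^-1 * (`|b - a|^-1 * `|z - a|) ^+ N /\
  `|(z - a) / (b - z) ^+ 2 -
    \sum_(k < N) k%:R * (b - a) ^- k.+1 * (z - a) ^+ k|
     <= 2 * `|b - a|^-1 * (2 * `|b - a|^-1 * `|z - a|) ^+ N.
Proof.
move=> ba zb rh; have [-> ->] := inv_expand ba zb.
have e k : (b - a) ^- k.+1 * (z - a) ^+ k = (b - a)^-1 * ((z - a) / (b - a)) ^+ k.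
  by rewrite exprMn exprVn exprS invfM -mulrA (mulrC (_ ^+ k)).
under eq_bigr do rewrite e.
under [X in _ /\ `|_ - X| <= _]eq_bigr do rewrite -mulrA e mulrCA.
rewrite -!mulr_sumr -!mulrBr !(normrM (b - a)^-1) normfV.
have e1 : `|b - a|^-1 * `|z - a| = `|(z - a) / (b - a)|.
  by rewrite normrM normfV mulrC.
rewrite -(mulrA 2 `|b - a|^-1 `|z - a|) e1.
by split; rewrite (mulrC 2 `|b - a|^-1) -[leRHS]mulrA ler_wpM2l ?invr_ge0 //
  ?geom_bound1 ?geom_bound2.
Qed.

Lemma near_small a b e : b != a -> 0 < e ->
  \forall z \near a^', z != a /\ z != b /\ `|(z - a) / (b - a)| <= e.
Proof.
move=> ba e0; have ba0 : 0 < `|b - a| by rewrite normr_gt0 subr_eq0.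
near=> z; have [|za1 za] := near (near_dnbhs_norm a (mulr_gt0 e0 ba0)) z => //.
have [|_ zb] := near (near_dnbhs_norm a ba0) z => //.
split=> //; split; first by apply: contraTneq zb => ->; rewrite ltxx.
by rewrite normrM normfV ler_pdivrMr // ltW.
Unshelve. all: by end_near. Qed.

Lemma near_neq a b : \forall z \near a^', z != b.
Proof.
have [<-|ab] := eqVneq a b.
  by near=> z; have [|] := near (near_dnbhs_norm a (@ltr01 K)) z.
rewrite eq_sym in ab; near=> z.
by have [|_ []] := near (near_small ab (@ltr01 K)) z.
Unshelve. all: by end_near. Qed.

Lemma near_notin (s : seq K) a : \forall z \near a^', z \notin s.
Proof.
elim: s => [|b s IH]; first by apply: nearW.
near=> z; rewrite in_cons negb_or; apply/andP; split.
  by apply: (near (near_neq a b) z).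
exact: (near IH z).
Unshelve. all: by end_near. Qed.

Lemma euler_taylor_inv a b : b != a ->
  euler_taylor (fun z => (b - z)^-1) (fun z => (z - a) / (b - z) ^+ 2) a
       (fun k => (b - a) ^- k.+1).
Proof.
move=> ba; have h0 : 0 < 2^-1 :> K by rewrite invr_gt0.
split.
  exists (2 * `|b - a|^-1), `|b - a|^-1; split; rewrite ?mulr_ge0 ?invr_ge0 //.
  near=> z => N; have [|_ [zb zr]] := near (near_small ba h0) z => //.
  by have [] := inv_bound N ba zb zr.
exists (2 * `|b - a|^-1), (2 * `|b - a|^-1); split; rewrite ?mulr_ge0 ?invr_ge0 //.
near=> z => N; have [|_ [zb zr]] := near (near_small ba h0) z => //.
by have [] := inv_bound N ba zb zr.
Unshelve. all: by end_near. Qed.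

(** Induction on [j], each step multiplying by the expansion of -1/(b - z). Coefficients 0 and 1 are
    singled out as the value and the derivative of the term at [a]; [eval_terms_derive]
    differentiates R through them. *)
Lemma euler_taylor_invX a b j : b != a -> exists c, [/\ euler_taylor (fun z => (z - b) ^- j)
  (fun z => - j%:R * (z - a) * (z - b) ^- j.+1) a c,
  c 0%N = (a - b) ^- j & c 1%N = - j%:R * (a - b) ^- j.+1].
Proof.
move=> ba; have ab0 : a - b != 0 by rewrite subr_eq0 eq_sym.
elim: j => [|j [c [IH c0 c1]]].
  exists (fun k => 1 *+ (k == 0%N)); split.
  - apply: euler_taylor_eq (euler_taylor_cst 1 a).
      by apply: nearW => z; rewrite expr0 invr1.
    by apply: nearW => z; rewrite oppr0 !mul0r.
  - by rewrite expr0 invr1.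
  - by rewrite oppr0 mul0r.
have h0 : 0 < 1 :> K by [].
have baE : b - a = - (a - b) by rewrite opprB.
exists (cauchy_prod c (fun k => -1 * (b - a) ^- k.+1)); split.
- apply: euler_taylor_eq (euler_taylor_M IH (euler_taylor_Z (-1) (euler_taylor_inv ba))).
    apply: nearW => z; rewrite mulN1r -invrN opprB.
    by rewrite -invfM -exprSr.
  near=> z; have [|_ [zb _]] := near (near_small ba h0) z => //.
  have zb' : z - b != 0 by rewrite subr_eq0.
  have -> : b - z = - (z - b) by rewrite opprB.
  rewrite sqrrN !exprS -natr1.
  have := expf_neq0 j zb'; move: ((z - b) ^+ j) => y y0; field.
  by rewrite y0 zb'.
- rewrite /cauchy_prod big_ord1 c0 baE expr1 mulN1r invrN opprK.
  by rewrite -invfM -exprSr.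
rewrite /cauchy_prod !big_ord_recl big_ord0 c0 c1 baE expr1 sqrrN !exprS -natr1.
have := expf_neq0 j ab0; move: ((a - b) ^+ j) => y y0; field.
by rewrite y0 ab0.
Unshelve. all: by end_near. Qed.

Definition shift_coef c k := if k is k'.+1 then c k' else 0 : K.

Lemma taylorX f a c : taylor f a c -> taylor (fun z => (z - a) * f z) a (shift_coef c).
Proof.
move=> fc; apply: taylor_coef (taylorM (taylor_x a) fc) => -[|k]; rewrite /cauchy_prod.
  by rewrite big_ord1 mul0r.
rewrite 2!big_ord_recl mul0r add0r mul1r subSS subn0 big1 ?addr0 // => i _.
by rewrite mul0r.
Qed.

Lemma taylorXn f a c m : taylor f a c ->
  taylor (fun z => (z - a) ^+ m * f z) a (iter m shift_coef c).
Proof.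
move=> fc; elim: m => [|m IH].
  by apply: taylor_eq fc; apply: nearW => z; rewrite mul1r.
by apply: taylor_eq (taylorX IH); apply: nearW => z; rewrite mulrA -exprS.
Qed.

Lemma iter_shift_coef c m k : iter m shift_coef c (m + k) = c k.
Proof. by elim: m => [|m IH] //; rewrite addSn iterS /=. Qed.

(* [f] has at most a pole at [a], with residue [w]. *)
Definition res_is f a w := exists m c,
  taylor (fun z => (z - a) ^+ m.+1 * f z) a c /\ c m = w.

(** The exponent in [res_is] is not canonical. Multiplying by further powers of [z - a] shifts the
    coefficients, so two functions can be brought to a common exponent. *)
Lemma res_is_raise f a w : res_is f a w -> exists m0, forall m, (m0 <= m)%N ->
  exists2 c, taylor (fun z => (z - a) ^+ m.+1 * f z) a c & c m = w.
Proof.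
move=> [m [c [fc cm]]]; exists m => m' mm'.
exists (iter (m' - m) shift_coef c); last by rewrite -{2}(subnK mm') iter_shift_coef.
apply: taylor_eq (taylorXn (m' - m) fc); apply: nearW => z.
by rewrite mulrA -exprD addnS subnK.
Qed.

Lemma res_is_common f g a v w : res_is f a v -> res_is g a w ->
  exists m c d, [/\ taylor (fun z => (z - a) ^+ m.+1 * f z) a c,
    taylor (fun z => (z - a) ^+ m.+1 * g z) a d, c m = v & d m = w].
Proof.
move=> /res_is_raise[m1 H1] /res_is_raise[m2 H2].
have [c ? ?] := H1 _ (leq_maxl m1 m2); have [d ? ?] := H2 _ (leq_maxr m1 m2).
by exists (maxn m1 m2), c, d.
Qed.

Lemma res_is_uniq f a v w : res_is f a v -> res_is f a w -> v = w.
Proof.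
move=> /res_is_common/[apply]-[m [c [d [fc fd <- <-]]]]; exact: taylor_uniq fc fd m.
Qed.

Lemma res_is_eq f g a w : (\forall z \near a^', f z = g z) ->
  res_is f a w -> res_is g a w.
Proof.
move=> fg [m [c [fc cm]]]; exists m, c; split=> //; apply: taylor_eq fc.
by near=> z; rewrite (near fg z).
Unshelve. all: by end_near. Qed.

Lemma res_isD f g a v w : res_is f a v -> res_is g a w ->
  res_is (fun z => f z + g z) a (v + w).
Proof.
move=> /res_is_common/[apply]-[m [c [d [fc fd <- <-]]]].
exists m, (fun k => c k + d k); split=> //; apply: taylor_eq (taylorD fc fd).
by apply: nearW => z; rewrite mulrDr.
Qed.

Lemma res_isZ u f a v : res_is f a v -> res_is (fun z => u * f z) a (u * v).
Proof.
move=> [m [c [fc <-]]]; exists m, (fun k => u * c k); split=> //.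
by apply: taylor_eq (taylorZ u fc); apply: nearW => z; rewrite mulrCA.
Qed.

Lemma res_is_tay f a c : taylor f a c -> res_is f a 0.
Proof. by move=> /taylorX fc; exists 0%N, (shift_coef c). Qed.

Lemma res_is_sum (I : Type) (s : seq I) (F : I -> K -> K) (v : I -> K) a :
  (forall i, res_is (F i) a (v i)) ->
  res_is (fun z => \sum_(i <- s) F i z) a (\sum_(i <- s) v i).
Proof.
move=> H; elim: s => [|i s IH].
  rewrite big_nil; apply: res_is_eq (res_is_tay (taylor_cst 0 a)).
  by apply: nearW => z; rewrite big_nil.
rewrite big_cons; apply: res_is_eq (res_isD (H i) IH).
by apply: nearW => z; rewrite big_cons.
Qed.

End TayExamples.

(** * The residues of R' phi - R phi^2 *)

Section ResidueFormula.
Variable K : numFieldType.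
Implicit Types (T R phi D E : K -> K) (a z : K) (c p e : nat -> K) (m : nat).

(* The residue at [a] of [R' phi - R phi^2], where [c] and [p] are the Taylor
   coefficients of [(z - a)^m R] and [(z - a) phi]. *)
Definition res_coef c p m : K :=
  cauchy_prod (fun k => k%:R * c k + - m%:R * c k) p m.+1 +
  -1 * cauchy_prod c (cauchy_prod p p) m.+1.

(** [R'] is tied to [R] only through the Leibniz rule for T = (z - a)^m R, with [T'] standing for z
    - a times the derivative of T. The expression is then multiplied by (z - a)^(m + 2), hence the
    coefficient of index [m.+1]. *)
Lemma res_is_coef T T' R R' phi a c p m : euler_taylor T T' a c ->
  (\forall z \near a^', (z - a) ^+ m * R z = T z) ->
  (\forall z \near a^', (z - a) ^+ m.+1 * R' z = T' z - m%:R * T z) ->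
  taylor (fun z => (z - a) * phi z) a p ->
  res_is (fun z => R' z * phi z - R z * phi z ^+ 2) a (res_coef c p m).
Proof.
move=> [Tc T'c] HR HR' Pp; exists m.+1.
exists (fun k => cauchy_prod (fun k => k%:R * c k + - m%:R * c k) p k +
  -1 * cauchy_prod c (cauchy_prod p p) k); split=> //.
apply: taylor_eq (taylorD (taylorM (taylorD T'c (taylorZ (- m%:R) Tc)) Pp)
  (taylorZ (-1) (taylorM Tc (taylorM Pp Pp)))).
near=> z; rewrite mulNr -(near HR' z) // -(near HR z) // !exprS expr0; ring.
Unshelve. all: by end_near. Qed.

(* [R' phi - R phi^2 = (R phi)' - R (phi^2 + phi')], with [D = phi'], and a
   derivative has no residue. *)
Lemma res_coef_finite T T' R R' phi D a c p e m : euler_taylor T T' a c ->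
  (\forall z \near a^', (z - a) ^+ m * R z = T z) ->
  (\forall z \near a^', (z - a) ^+ m.+1 * R' z = T' z - m%:R * T z) ->
  euler_taylor (fun z => (z - a) * phi z)
    (fun z => (z - a) * phi z + (z - a) ^+ 2 * D z) a p ->
  taylor (fun z => phi z ^+ 2 + D z) a e ->
  res_coef c p m = - cauchy_prod (shift_coef c) e m.
Proof.
move=> Tc HR HR' Pp Ee; have := res_is_coef Tc HR HR' Pp.1.
move/res_is_uniq; apply.
(* For G = (z - a)^(m + 1) R phi with coefficients g_k, the function (z - a)^(m + 2) (R phi)' has
   coefficients (k - (m + 1)) g_k, and the residue sits at k = m + 1. *)
have d0 : res_is (fun z => R' z * phi z + R z * D z) a 0.
  have [P1 P2] := euler_taylor_M Tc Pp; exists m.+1.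
  exists (fun k => k%:R * cauchy_prod c p k + - m.+1%:R * cauchy_prod c p k); split.
    apply: taylor_eq (taylorD P2 (taylorZ (- m.+1%:R) P1)).
    near=> z; have r1 := near HR' z; have r2 := near HR z.
    have -> : T' z = (z - a) ^+ m.+1 * R' z + m%:R * T z.
      by rewrite r1 // subrK.
    rewrite -r2 // !exprS expr0 -natr1.
    move: (m%:R : K) ((z - a) ^+ m) (R' z) (R z) (phi z) (D z) (z - a) => *; ring.
  by rewrite mulNr subrr.
have d1 : res_is (fun z => R z * (phi z ^+ 2 + D z)) a (cauchy_prod (shift_coef c) e m).
  exists m, (cauchy_prod (shift_coef c) e); split=> //.
  apply: taylor_eq (taylorM (taylorX Tc.1) Ee).
  by near=> z; rewrite -(near HR z) // (exprS _ m) !mulrA.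
rewrite -mulN1r -[X in res_is _ _ X]add0r.
apply: res_is_eq (res_isD d0 (res_isZ (-1) d1)).
by apply: nearW => z; ring.
Unshelve. all: by end_near. Qed.

Lemma cvg_sum_seq (I : Type) (s : seq I) (u : nat -> I -> K) (l : I -> K) :
  (forall i, u n i @[n --> \oo] --> l i) ->
  \sum_(i <- s) u n i @[n --> \oo] --> \sum_(i <- s) l i.
Proof. by move=> H; apply: cvg_big => //; exact: add_continuous. Qed.

Lemma cauchy_prod_cvg (c d : nat -> nat -> K) (c' d' : nat -> K) k :
  (forall i, c n i @[n --> \oo] --> c' i) ->
  (forall i, d n i @[n --> \oo] --> d' i) ->
  cauchy_prod (c n) (d n) k @[n --> \oo] --> cauchy_prod c' d' k.
Proof. by move=> cc dd; apply: cvg_sum_seq => i; apply: cvgM. Qed.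

Lemma res_coef_cvg c (p : nat -> nat -> K) (p' : nat -> K) m :
  (forall i, p n i @[n --> \oo] --> p' i) ->
  res_coef c (p n) m @[n --> \oo] --> res_coef c p' m.
Proof.
move=> pp; apply: cvgD; first by apply: cauchy_prod_cvg => // i; exact: cvg_cst.
apply: cvgM; first exact: cvg_cst.
apply: cauchy_prod_cvg => // i; [exact: cvg_cst|exact: cauchy_prod_cvg].
Qed.

Lemma cvg_norm_le (u : nat -> K) (l B : K) : u n @[n --> \oo] --> l ->
  (forall n, `|u n| <= B) -> `|l| <= B.
Proof.
move=> /cvgrPdist_lt ul uB; apply/ler_addgt0Pr => e e0.
have [N _ /(_ N (leqnn N)) HN] := ul e e0.
rewrite -(subrK (u N) l) addrC; apply: le_trans (ler_normD _ _) _.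
by apply: lerD => //; exact: ltW.
Qed.

Lemma taylor_lim (t : nat -> K -> K) (c : nat -> nat -> K) a (f : K -> K)
    (d : nat -> K) (C rho : K) : 0 <= C -> 0 <= rho ->
  (\forall z \near a^', forall n N,
    `|t n z - \sum_(k < N) c n k * (z - a) ^+ k| <= C * (rho * `|z - a|) ^+ N) ->
  (\forall z \near a^', t n z @[n --> \oo] --> f z) ->
  (forall k, c n k @[n --> \oo] --> d k) -> taylor f a d.
Proof.
move=> C0 r0 H Hf Hc; exists C, rho; split=> //; near=> z => N.
apply: (@cvg_norm_le (fun n => t n z - \sum_(k < N) c n k * (z - a) ^+ k)).
  apply: cvgB; first exact: (near Hf z).
  by apply: cvg_sum_seq => i; apply: cvgM; [exact: Hc|exact: cvg_cst].
by move=> n; apply: (near H z).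
Unshelve. all: by end_near. Qed.

Local Notation H := (harmonic_number K).

Lemma harmonic_numberS n : H n.+1 = H n + n.+1%:R^-1.
Proof. by rewrite /harmonic_number /series /= big_nat_recr. Qed.

Lemma harmonic_number0 : H 0 = 0.
Proof. by rewrite /harmonic_number /series /= big_geq. Qed.

(** Since u_m u_n = (u_m - u_n) / (n - m), the coefficient of u_m in the sum of the products with n
    != m is twice the sum of 1/(n - m) over 0 <= n <= N, n != m, which is H_(N-m) - H_m. *)
Lemma harmonic_square (s : K) N : (forall n, n%:R != s) ->
  let u n := (n%:R - s)^-1 in
  (\sum_(n < N.+1) u n) ^+ 2 - \sum_(n < N.+1) u n ^+ 2 =
  2 * \sum_(n < N.+1) u n * (H (N - n) - H n).
Proof.
move=> sn u; have u0 n : n%:R - s != 0 by rewrite subr_eq0.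
elim: N => [|N IH].
  by rewrite !big_ord1 subrr subnn subrr mulr0 mulr0.
have E1 : \sum_(n < N.+1) u n * (H (N.+1 - n) - H n) =
    \sum_(n < N.+1) u n * (H (N - n) - H n) +
    \sum_(n < N.+1) u n * (N.+1 - n)%:R^-1.
  rewrite -big_split; apply: eq_bigr => -[n /= nN] _.
  by rewrite subSn // harmonic_numberS -subSn //; ring.
have E2 : u N.+1 * \sum_(n < N.+1) u n =
    \sum_(n < N.+1) u n * (N.+1 - n)%:R^-1 - u N.+1 * H N.+1.
  have -> : H N.+1 = \sum_(n < N.+1) (N.+1 - n)%:R^-1.
    rewrite /harmonic_number /series /= big_mkord (reindex_inj rev_ord_inj) /=.
    by apply: eq_bigr => -[i /= iN] _; rewrite subSS subSn.
  rewrite !mulr_sumr -sumrB; apply: eq_bigr => -[n /= nN] _.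
  have nN' : N.+1%:R - n%:R != 0 :> K by rewrite subr_eq0 eqr_nat gtn_eqF.
  rewrite natrB ?(ltnW nN) // /u; move: nN' (u0 n) (u0 N.+1).
  by move: (n%:R : K) (N.+1%:R : K) => x y xy xs ys; field; rewrite xy xs ys.
rewrite [X in X ^+ 2]big_ord_recr [X in _ - X]big_ord_recr.
rewrite [X in _ = 2 * X]big_ord_recr /= subnn harmonic_number0 E1.
transitivity (((\sum_(n < N.+1) u n) ^+ 2 - \sum_(n < N.+1) u n ^+ 2) +
   2 * (u N.+1 * \sum_(n < N.+1) u n)); first by ring.
by rewrite IH E2; ring.
Qed.

(* [digamma_sum N] tends to [fun z => digamma (- z) + euler_gamma], and
   [digamma_deriv_sum N] is the derivative of [digamma_sum N]. *)
Definition psi_term n (z : K) : K := n.+1%:R^-1 - (n.+1%:R - z)^-1.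

Definition digamma_sum N (z : K) : K := z^-1 + \sum_(n < N) psi_term n z.
Definition digamma_deriv_sum N (z : K) : K :=
  - z ^- 2 - \sum_(n < N) (n.+1%:R - z) ^- 2.

(* Since [weight N n] is close to [H n.+1] for fixed [n], the next identity is
   what brings the harmonic numbers in. *)
Definition weight N n : K := H N - H (N - n.+1) + H n.+1.

Lemma sum_inv_harmonic N : \sum_(n < N) n.+1%:R^-1 = H N.
Proof. by rewrite /harmonic_number /series /= big_mkord. Qed.

(** Here phi_N = H_N - A and phi_N' = - B, so [harmonic_square] applies to A^2 - B. The term n = 0
    drops out, its coefficient being 2 (H_N - H_0) - 2 H_N: this is the cancellation of the pole at
    0. *)
Lemma digamma_sum_square N (s : K) : (forall n, n%:R != s) ->
  digamma_sum N s ^+ 2 + digamma_deriv_sum N s =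
  H N ^+ 2 - 2 * \sum_(n < N) weight N n * (n.+1%:R - s)^-1.
Proof.
move=> sn; have /= := harmonic_square N sn; pose u n := (n%:R - s)^-1.
rewrite -/(u _); set A := \sum_(n < N.+1) _; set B := \sum_(n < N.+1) _.
set X := \sum_(n < N.+1) _ => E.
have A' : A = - s^-1 + \sum_(n < N) u n.+1.
  by rewrite /A big_ord_recl sub0r invrN.
have B' : B = s ^- 2 + \sum_(n < N) (n.+1%:R - s) ^- 2.
  rewrite /B big_ord_recl sub0r invrN sqrrN exprVn; congr (_ + _).
  by apply: eq_bigr => n _; rewrite exprVn.
have X' : X = - s^-1 * H N + \sum_(n < N) u n.+1 * (H (N - n.+1) - H n.+1).
  by rewrite /X big_ord_recl sub0r invrN subn0 harmonic_number0 subr0.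
have W : \sum_(n < N) weight N n * (n.+1%:R - s)^-1 =
    H N * \sum_(n < N) u n.+1 - \sum_(n < N) u n.+1 * (H (N - n.+1) - H n.+1).
  rewrite mulr_sumr -sumrB; apply: eq_bigr => n _; rewrite /weight /u; ring.
rewrite W /digamma_sum /digamma_deriv_sum /psi_term sumrB sum_inv_harmonic.
move: E; rewrite X' B' A'.
set S := \sum_(n < N) u n.+1; set Q := \sum_(n < N) (n.+1%:R - s) ^- 2.
set Y := \sum_(n < N) u n.+1 * _; move: (s^-1) (s ^- 2) S Q Y (H N).
clear => t t2 S Q Y h E; apply/eqP; rewrite -subr_eq0; apply/eqP.
transitivity ((- t + S) ^+ 2 - (t2 + Q) - 2 * (- t * h + Y)); first by ring.
by rewrite E subrr.
Qed.

End ResidueFormula.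

(** * Summable bounds for the terms of the digamma series *)

Section ResidueLimit.
Variable K : numFieldType.
Implicit Types (T R phi f g : K -> K) (a z delta : K) (c : nat -> K).
Local Notation H := (harmonic_number K).

(** Telescoping, from 1/(k + 1)^2 <= 1/k - 1/(k + 1). Starting at [p] gives tails that can be made
    small. *)
Lemma sum_inv_sq p N : (0 < p)%N ->
  \sum_(n < N) (n + p).+1%:R ^- 2 <= p%:R^-1 - (N + p)%:R^-1 :> K.
Proof.
move=> p0; elim: N => [|N IH]; first by rewrite big_ord0 add0n subrr.
rewrite big_ord_recr /=; apply: le_trans (lerD IH (lexx _)) _.
rewrite -addrA lerD2l -lerBrDl opprK [leRHS]addrC.
have k0 : 0 < (N + p)%:R :> K by rewrite ltr0n addn_gt0 p0 orbT.
have k1 : 0 < (N + p).+1%:R :> K by rewrite ltr0n.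
have -> : (N + p)%:R^-1 - (N.+1 + p)%:R^-1 = ((N + p)%:R * (N + p).+1%:R)^-1 :> K.
  rewrite addSn; move: (lt0r_neq0 k0) (lt0r_neq0 k1); rewrite -natr1.
  by move: ((N + p)%:R : K) => x x0 x1; field; rewrite x0 x1.
by rewrite expr2 lef_pV2 ?posrE ?mulr_gt0 // ler_pM2r // ler_nat.
Qed.

Lemma sum_inv_sq_le2 N : \sum_(n < N) n.+1%:R ^- 2 <= 2 :> K.
Proof.
case: N => [|N]; first by rewrite big_ord0.
rewrite big_ord_recl expr1n invr1 -[2]/(1 + 1) lerD2l.
under eq_bigr do rewrite [_.+1]/= -addn1.
apply: le_trans (sum_inv_sq N (ltn0Sn 0)) _.
by rewrite invr1 lerBlDr lerDl invr_ge0.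
Qed.

Lemma euler_taylor_sum (I : Type) (s : seq I) (F F' : I -> K -> K) (c : I -> nat -> K) a :
  (forall i, euler_taylor (F i) (F' i) a (c i)) ->
  euler_taylor (fun z => \sum_(i <- s) F i z) (fun z => \sum_(i <- s) F' i z) a
       (fun k => \sum_(i <- s) c i k).
Proof.
move=> HF; elim: s => [|i s IH].
  have := euler_taylor_cst 0 a; congr euler_taylor; apply/funext => x; rewrite big_nil //.
  by rewrite mul0rn.
have := euler_taylor_D (HF i) IH; congr euler_taylor; apply/funext => x;
  by rewrite big_cons.
Qed.

Definition psi_coef a n k : K := n.+1%:R^-1 *+ (k == 0%N) + -1 * (n.+1%:R - a) ^- k.+1.

Lemma euler_taylor_psi_term a n : n.+1%:R != a ->
  euler_taylor (psi_term n) (fun z => - ((z - a) / (n.+1%:R - z) ^+ 2)) a (psi_coef a n).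
Proof.
move=> na; apply: euler_taylor_eq (euler_taylor_D
  (euler_taylor_cst n.+1%:R^-1 a) (euler_taylor_Z (-1) (euler_taylor_inv na))).
  by apply: nearW => z; rewrite mulN1r.
by apply: nearW => z; rewrite mulN1r add0r.
Qed.

Section Bounds.
Variables (a delta : K).
Hypothesis delta0 : 0 < delta.
(** A quantitative form of [a] not being a positive integer: the linear growth in [n] is what makes
    the estimates below summable. *)
Hypothesis adelta : forall n, delta * n.+1%:R <= `|n.+1%:R - a|.

Lemma away_neq n : n.+1%:R != a.
Proof.
rewrite -subr_eq0 -normr_gt0; apply: lt_le_trans (adelta n).
by rewrite mulr_gt0.
Qed.

Lemma away_inv n : `|n.+1%:R - a|^-1 <= delta^-1 * n.+1%:R^-1.
Proof.
have h : 0 < delta * n.+1%:R by rewrite mulr_gt0.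
by rewrite -invfM lef_pV2 ?posrE // (lt_le_trans h).
Qed.

Lemma away_inv_le n : `|n.+1%:R - a|^-1 <= delta^-1.
Proof.
apply: le_trans (away_inv n) _; rewrite ler_piMr ?invr_ge0 ?(ltW delta0) //.
by rewrite invf_le1 // ler1n.
Qed.

(** For [k = 0] the two terms are each of order 1/n and only their difference is O(n^-2); for
    positive [k] the power of the inverse distance is already at least 2. *)
Lemma psi_coef_bound k : exists M : K, forall n, `|psi_coef a n k| <= M * n.+1%:R ^- 2.
Proof.
case: k => [|k].
  exists (`|a| * delta^-1) => n; rewrite /psi_coef mulr1n mulN1r expr1.
  have na : n.+1%:R - a != 0 by rewrite subr_eq0 away_neq.
  have -> : n.+1%:R^-1 - (n.+1%:R - a)^-1 = - a * n.+1%:R^-1 * (n.+1%:R - a)^-1.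
    have : n.+1%:R != 0 :> K by rewrite pnatr_eq0.
    by move: (n.+1%:R : K) na => x xa x0; field; rewrite x0 xa.
  rewrite 2!normrM normrN !normfV normr_nat -!mulrA ler_wpM2l //.
  rewrite -exprVn expr2 mulrCA ler_wpM2l ?invr_ge0 //.
  exact: away_inv.
exists (delta^-1 ^+ k.+2) => n; rewrite /psi_coef mulr0n add0r mulN1r normrN.
rewrite normfV normrX -!exprVn -(add2n k) !exprD [leRHS]mulrAC -exprMn.
apply: ler_pM; rewrite ?exprn_ge0 ?invr_ge0 //.
  by apply: lerXn2r; rewrite ?nnegrE ?mulr_ge0 ?invr_ge0 ?(ltW delta0) ?away_inv.
by apply: lerXn2r; rewrite ?nnegrE ?invr_ge0 ?(ltW delta0) ?away_inv_le.
Qed.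

(** One neighbourhood of radius [delta / 2] serves every [n], because all distances [|n.+1%:R - a|]
    are at least [delta]. *)
Lemma near_away : \forall z \near a^', forall n,
  z != n.+1%:R /\ `|(z - a) / (n.+1%:R - a)| <= 2^-1.
Proof.
have d0 : 0 < delta / 2 by rewrite divr_gt0.
near=> z => n; have [|_ za] := near (near_dnbhs_norm a d0) z => //.
have h : `|(z - a) / (n.+1%:R - a)| <= 2^-1.
  rewrite normrM normfV; apply: (@le_trans _ _ (delta / 2 * delta^-1)).
    by apply: ler_pM => //; [exact: ltW|exact: away_inv_le].
  by rewrite mulrAC divff ?gt_eqF // mul1r.
split=> //; apply: contraTneq h => ->.
rewrite divff ?subr_eq0 ?away_neq // normr1.
by rewrite lt_geF // invf_lt1 // ltr1n.
Unshelve. all: by end_near. Qed.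

Lemma near_not_nat : \forall z \near a^', forall n, n%:R != z.
Proof.
near=> z => -[|n]; rewrite eq_sym.
  by apply: (near (near_neq a 0) z).
by have [|] := near near_away z _ n.
Unshelve. all: by end_near. Qed.

(** The factor n^-2 lets the remainders be summed over [n]. The case [N = 0] stands apart, since
    there the decay comes from the difference in [psi_term]; afterwards the constant 1/(n + 1)
    cancels against coefficient 0. In the constant, [|a| + 1] bounds [|z|] and 2 comes from
    [geom_half]. *)
Lemma psi_term_bound : exists C rho : K, [/\ 0 <= C, 0 <= rho &
  \forall z \near a^', forall n N,
  `|psi_term n z - \sum_(k < N) psi_coef a n k * (z - a) ^+ k| <=
  C * (rho * `|z - a|) ^+ N * n.+1%:R ^- 2].
Proof.
have di0 : 0 <= delta^-1 by rewrite invr_ge0 ltW.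
have C0 : 0 <= 2 * (`|a| + 1) * delta^-1.
  by rewrite mulr_ge0 // mulr_ge0 // addr_ge0.
exists (2 * (`|a| + 1) * delta^-1), delta^-1; split=> //.
near=> z => n N; have [|za rh] := near near_away z _ n => //.
have [|_ z1] := near (near_dnbhs_norm a (@ltr01 K)) z => //.
have na0 := away_neq n.
have nz : n.+1%:R - z != 0 by rewrite subr_eq0 eq_sym.
case: N => [|N].
  rewrite big_ord0 subr0 expr0 mulr1 /psi_term.
  have -> : n.+1%:R^-1 - (n.+1%:R - z)^-1 = - z * n.+1%:R^-1 * (n.+1%:R - z)^-1.
    have : n.+1%:R != 0 :> K by rewrite pnatr_eq0.
    by move: (n.+1%:R : K) nz => x xz x0; field; rewrite x0 xz.
  rewrite 2!normrM normrN normfV normr_nat.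
  have -> : 2 * (`|a| + 1) * delta^-1 * n.+1%:R ^- 2 =
    (`|a| + 1) * n.+1%:R^-1 * (2 * (delta^-1 * n.+1%:R^-1)).
    by rewrite -exprVn; ring.
  apply: ler_pM => //.
  rewrite ler_wpM2r ?invr_ge0 // -[z in `|z|](subrK a) addrC.
    apply: le_trans (ler_normD _ _) _; rewrite lerD2l; exact: ltW.
  rewrite (inv_expand na0 za).1 normrM normfV mulrC.
  by apply: ler_pM; rewrite ?invr_ge0 ?away_inv // (geom_half rh).2.
have -> : psi_term n z - \sum_(k < N.+1) psi_coef a n k * (z - a) ^+ k =
  - ((n.+1%:R - z)^-1 - \sum_(k < N.+1) (n.+1%:R - a) ^- k.+1 * (z - a) ^+ k).
  rewrite /psi_term; under eq_bigr do rewrite /psi_coef mulrDl mulN1r mulNr.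
  rewrite big_split /= sumrN [in LHS]big_ord_recl big1 => [|i _].
    by rewrite /= mulr1n expr0 mulr1; ring.
  by rewrite mul0r.
rewrite normrN; apply: le_trans (inv_bound _ na0 za rh).1 _.
have := away_inv n; have := away_inv_le n.
move: (`|n.+1%:R - a|^-1) (invr_ge0 `|n.+1%:R - a|) => I; rewrite normr_ge0 => I0.
rewrite -exprVn; move: (n.+1%:R^-1 : K) (invr_ge0 (n.+1%:R : K)) => J.
rewrite ler0n; move: (delta^-1) di0 => D D0 J0 ID IDJ.
(* Of the [N.+2] factors [I], two are bounded by [D * J], which yields the summable [J ^+ 2], and
   the others by [D]. *)
have -> : 2 * I * (I * `|z - a|) ^+ N.+1 = 2 * (I ^+ 2 * I ^+ N) * `|z - a| ^+ N.+1.
  by rewrite exprMn [I ^+ N.+1]exprS; ring.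
have -> : 2 * (`|a| + 1) * D * (D * `|z - a|) ^+ N.+1 * J ^+ 2 =
    2 * ((`|a| + 1) * ((D * J) ^+ 2 * D ^+ N)) * `|z - a| ^+ N.+1.
  by rewrite exprMn [D ^+ N.+1]exprS; ring.
rewrite ler_wpM2r ?exprn_ge0 // ler_wpM2l //.
apply: (@le_trans _ _ ((D * J) ^+ 2 * D ^+ N)).
  by apply: ler_pM; rewrite ?exprn_ge0 //; apply: lerXn2r;
    rewrite ?nnegrE ?mulr_ge0.
by rewrite ler_peMl ?lerDr // mulr_ge0 ?exprn_ge0 ?mulr_ge0.
Unshelve. all: by end_near. Qed.

End Bounds.
End ResidueLimit.

(** The form of completeness that the abstract field must supply; [inv_sq_completeC] provides it for
    the complex numbers. *)
Definition inv_sq_complete (K : numFieldType) := forall (t : nat -> K) (M : K),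
  (forall n, `|t n| <= M * n.+1%:R ^- 2) ->
  exists l : K, \sum_(n < N) t n @[N --> \oo] --> l.

Section ResidueAtPole.
Variable K : numFieldType.
Implicit Types (T R phi f g : K -> K) (a z delta : K) (c : nat -> K).
Local Notation H := (harmonic_number K).

(* The Taylor coefficients at [a] of [digamma_sum N ^+ 2 + digamma_deriv_sum N],
   whose poles at 0 cancel. *)
Definition square_coef a N k : K :=
  H N ^+ 2 *+ (k == 0%N) +
  -2 * \sum_(n < N) weight K N n * (n.+1%:R - a) ^- k.+1.

(** This isolates the term 1/z of [digamma_sum]. Its coefficients are the same for every N, so their
    existence is enough for the limit. At [a = 0] the quotient is the constant 1 off [a]. *)
Lemma euler_taylor_div a : exists y, euler_taylor (fun z => (z - a) / z)
  (fun z => (z - a) / z - (z - a) ^+ 2 / z ^+ 2) a y.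
Proof.
have [->|a0] := eqVneq a 0.
  exists (fun k => 1 *+ (k == 0%N)); apply: euler_taylor_eq (euler_taylor_cst 1 0).
    near=> z; have [|z0 _] := near (near_dnbhs_norm 0 (@ltr01 K)) z => //.
    by rewrite subr0 divff.
  near=> z; have [|z0 _] := near (near_dnbhs_norm 0 (@ltr01 K)) z => //.
  by rewrite subr0 !divff ?expf_neq0 // subrr.
eexists; apply: euler_taylor_eq (euler_taylor_M (euler_taylor_x a)
  (euler_taylor_Z (-1) (euler_taylor_inv (b := 0) _))).
- by apply: nearW => z; rewrite sub0r mulN1r invrN opprK.
- apply: nearW => z; rewrite sub0r mulN1r invrN opprK sqrrN; ring.
- by rewrite eq_sym.
Unshelve. all: by end_near. Qed.

Section Pole.
Variables (a delta : K).
Hypothesis delta0 : 0 < delta.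
Hypothesis adelta : forall n, delta * n.+1%:R <= `|n.+1%:R - a|.
Hypothesis complete : inv_sq_complete K.

Lemma psi_coef_cvg k :
  exists l : K, \sum_(n < N) psi_coef a n k @[N --> \oo] --> l.
Proof.
have [M HM] := psi_coef_bound delta0 adelta k.
exact: complete HM.
Qed.

Lemma taylor_psi (psi : K -> K) (B : nat -> K) :
  (\forall z \near a^', \sum_(n < N) psi_term n z @[N --> \oo] --> psi z) ->
  (forall k, \sum_(n < N) psi_coef a n k @[N --> \oo] --> B k) ->
  taylor psi a B.
Proof.
move=> Hpsi HB; have [C [r [C0 r0 Hb]]] := psi_term_bound delta0 adelta.
apply: (taylor_lim (C := C * 2) _ r0 _ Hpsi HB); first by rewrite mulr_ge0.
near=> z => m N.
have -> : \sum_(n < m) psi_term n z -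
    \sum_(k < N) (\sum_(n < m) psi_coef a n k) * (z - a) ^+ k =
  \sum_(n < m) (psi_term n z - \sum_(k < N) psi_coef a n k * (z - a) ^+ k).
  rewrite [RHS]sumrB [in RHS]exchange_big /=; congr (_ - _).
  by apply: eq_bigr => k _; rewrite mulr_suml.
apply: le_trans (ler_norm_sum _ _ _) _.
apply: (@le_trans _ _ (\sum_(n < m) C * (r * `|z - a|) ^+ N * n.+1%:R ^- 2)).
  by apply: ler_sum => n _; apply: (near Hb z).
rewrite -mulr_sumr [leRHS]mulrAC ler_wpM2l ?sum_inv_sq_le2 //.
by rewrite !mulr_ge0 ?exprn_ge0 ?mulr_ge0.
Unshelve. all: by end_near. Qed.

Lemma euler_taylor_digamma_sum N (y : nat -> K) :
  euler_taylor (fun z => (z - a) / z)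
    (fun z => (z - a) / z - (z - a) ^+ 2 / z ^+ 2) a y ->
  euler_taylor (fun z => (z - a) * digamma_sum N z)
    (fun z => (z - a) * digamma_sum N z + (z - a) ^+ 2 * digamma_deriv_sum N z) a
    (fun k => y k + cauchy_prod (fun k => (k == 1%N)%:R)
       (fun k => \sum_(n < N) psi_coef a n k) k).
Proof.
move=> Hy.
have Hs := euler_taylor_sum (index_enum 'I_N)
  (fun n : 'I_N => euler_taylor_psi_term (away_neq delta0 adelta n)).
apply: euler_taylor_eq (euler_taylor_D Hy (euler_taylor_M (euler_taylor_x a) Hs)).
  by apply: nearW => z; rewrite /digamma_sum; ring.
apply: nearW => z; rewrite /digamma_sum /digamma_deriv_sum.
rewrite sumrN -mulr_sumr; ring.
Qed.

Lemma taylor_square N :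
  taylor (fun z => digamma_sum N z ^+ 2 + digamma_deriv_sum N z) a (square_coef a N).
Proof.
have Hs := euler_taylor_sum (index_enum 'I_N) (fun n : 'I_N =>
  euler_taylor_Z (weight K N n) (euler_taylor_inv (away_neq delta0 adelta n))).
apply: taylor_eq (taylorD (taylor_cst (H N ^+ 2) a) (taylorZ (-2) Hs.1)).
near=> z; rewrite digamma_sum_square ?mulNr //.
by apply: (near (near_not_nat delta0 adelta) z).
Unshelve. all: by end_near. Qed.

(** The coefficients in [square_coef] contain the divergent [H N ^+ 2], so their combination is
    first turned by [res_coef_finite] into [res_coef], which is polynomial in the convergent
    coefficients of (z - a) phi_N. *)
Lemma residue_limit T T' R R' phi c m : euler_taylor T T' a c ->
  (\forall z \near a^', (z - a) ^+ m * R z = T z) ->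
  (\forall z \near a^', (z - a) ^+ m.+1 * R' z = T' z - m%:R * T z) ->
  (\forall z \near a^', digamma_sum N z @[N --> \oo] --> phi z) ->
  exists2 l, res_is (fun z => R' z * phi z - R z * phi z ^+ 2) a l &
    - cauchy_prod (shift_coef c) (square_coef a N) m @[N --> \oo] --> l.
Proof.
move=> Tc HR HR' Hphi; have [y Hy] := euler_taylor_div a.
have [B HB] := choice psi_coef_cvg.
pose x1 k : K := (k == 1%N)%:R.
pose p N k := y k + cauchy_prod x1 (fun k => \sum_(n < N) psi_coef a n k) k.
have Pp : taylor (fun z => (z - a) * phi z) a (fun k => y k + cauchy_prod x1 B k).
  have Hpsi : \forall z \near a^',
      \sum_(n < N) psi_term n z @[N --> \oo] --> phi z - z^-1.
    near=> z; have := near Hphi z.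
    have -> : (fun N => \sum_(n < N) psi_term n z) = fun N => digamma_sum N z - z^-1.
      by apply/funext => N; rewrite /digamma_sum addrC addKr.
    by move=> H; apply: cvgB; [exact: H|exact: cvg_cst].
  have := taylorD Hy.1 (taylorM (taylor_x a) (taylor_psi Hpsi HB)).
  by apply: taylor_eq; apply: nearW => z; ring.
exists (res_coef c (fun k => y k + cauchy_prod x1 B k) m).
  exact: res_is_coef Tc HR HR' Pp.
have -> : (fun N => - cauchy_prod (shift_coef c) (square_coef a N) m) =
  (fun N => res_coef c (p N) m).
  apply/funext => N; apply/esym.
  exact: res_coef_finite HR HR' (euler_taylor_digamma_sum N Hy) (taylor_square N).
apply: res_coef_cvg => k; apply: cvgD; first exact: cvg_cst.
by apply: cauchy_prod_cvg => // i; exact: cvg_cst.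
Unshelve. all: by end_near. Qed.

(** When [a != b] the term is regular at [a] and the finite expressions contribute exactly 0, even
    at [a = 0] where phi has a pole, since phi_N^2 + phi_N' has none there. *)
Lemma residue_pole_part phi b j :
  (\forall z \near a^', digamma_sum N z @[N --> \oo] --> phi z) ->
  exists2 l, res_is (fun z => - j.+1%:R * (z - b) ^- j.+2 * phi z
       - (z - b) ^- j.+1 * phi z ^+ 2) a l &
    (if a == b then - square_coef a N j else 0) @[N --> \oo] --> l.
Proof.
move=> Hphi; have [ab|ab] := eqVneq a b.
  have [||l Hl Hc] := residue_limit (T := fun=> 1) (T' := fun=> 0)
    (c := fun k => 1 *+ (k == 0%N)) (m := j.+1) (R := fun z => (z - b) ^- j.+1)
    (R' := fun z => - j.+1%:R * (z - b) ^- j.+2) (euler_taylor_cst 1 a) _ _ Hphi.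
  - near=> z; have [|za _] := near (near_dnbhs_norm a (@ltr01 K)) z => //.
    by rewrite -ab divff // expf_neq0 // subr_eq0.
  - near=> z; have [|za _] := near (near_dnbhs_norm a (@ltr01 K)) z => //.
    by rewrite -ab mulrCA divff ?mulr1 ?sub0r // expf_neq0 // subr_eq0.
  exists l => //; apply: cvg_trans Hc; apply: near_eq_cvg; apply: nearW => N.
  (* As (z - b)^(j + 1) R = 1, the product with the shifted constant series picks out coefficient
     [j]. *)
  congr (- _); rewrite /cauchy_prod 2!big_ord_recl /= mul0r add0r mul1r subSS subn0.
  by rewrite big1 ?addr0 // => i _; rewrite mul0r.
have ba : b != a by rewrite eq_sym.
have [c [Hc _ _]] := euler_taylor_invX j.+1 ba.
have [||l Hl Hl2] := residue_limit (m := 0) (R := fun z => (z - b) ^- j.+1)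
    (R' := fun z => - j.+1%:R * (z - b) ^- j.+2) Hc _ _ Hphi.
- by apply: nearW => z; rewrite expr0 mul1r.
- by apply: nearW => z; rewrite mul0r subr0 expr1; ring.
exists l => //; apply: cvg_trans Hl2; apply: near_eq_cvg; apply: nearW => N.
by rewrite /cauchy_prod big_ord1 mul0r oppr0.
Unshelve. all: by end_near. Qed.

End Pole.
End ResidueAtPole.

(** * Partial fractions *)

Section PartialFractions.
Variable K : fieldType.
Implicit Types (s : seq K) (f g : K -> K) (a b w z : K) (P : {poly K})
  (L : seq (K * K * nat)).

(* [(c, b, j)] stands for the term [c / (z - b) ^ (j + 1)]. *)
Definition eval_terms L z : K := \sum_(t <- L) t.1.1 * (z - t.1.2) ^- t.2.+1.

(** Only existence is at stake: entries of [L] may repeat, and equality is asked off [s], where no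
    division by zero interferes. *)
Definition partial_fraction s f := exists P L, all (fun t => t.1.2 \in s) L /\
  forall z, z \notin s -> f z = P.[z] + eval_terms L z.

Lemma partial_fraction_eq s f g : (forall z, z \notin s -> f z = g z) ->
  partial_fraction s f -> partial_fraction s g.
Proof.
by move=> fg [P [L [sL fE]]]; exists P, L; split=> // z zs; rewrite -fg // fE.
Qed.

Lemma partial_fractionD s f g : partial_fraction s f -> partial_fraction s g ->
  partial_fraction s (fun z => f z + g z).
Proof.
move=> [P [L [sL fE]]] [P' [L' [sL' gE]]]; exists (P + P'), (L ++ L').
split=> [|z zs]; first by rewrite all_cat sL sL'.
by rewrite fE // gE // hornerD /eval_terms big_cat /= addrACA.
Qed.

Lemma partial_fractionZ s w f : partial_fraction s f ->
  partial_fraction s (fun z => w * f z).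
Proof.
move=> [P [L [sL fE]]]; exists (w *: P), [seq (w * t.1.1, t.1.2, t.2) | t <- L].
split=> [|z zs]; first by rewrite all_map.
rewrite fE // hornerZ mulrDr /eval_terms big_map mulr_sumr; congr (_ + _).
by apply: eq_bigr => t _; rewrite mulrA.
Qed.

Lemma partial_fraction_poly s P : partial_fraction s (fun z => P.[z]).
Proof. by exists P, [::]; split=> // z _; rewrite /eval_terms big_nil addr0. Qed.

Lemma partial_fraction_term s b j : b \in s ->
  partial_fraction s (fun z => (z - b) ^- j.+1).
Proof.
move=> bs; exists 0, [:: (1, b, j)]; split=> [|z _]; first by rewrite /= bs.
by rewrite horner0 add0r /eval_terms big_seq1 mul1r.
Qed.

Lemma partial_fraction_inv s a : a \in s -> partial_fraction s (fun z => (z - a)^-1).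
Proof. exact: (@partial_fraction_term s a 0%N). Qed.

(** For [a != b], the relation (z - a) - (z - b) = b - a lowers the exponent of z - b by one at each
    step. *)
Lemma partial_fraction_div_term s a b j : a \in s -> b \in s ->
  partial_fraction s (fun z => (z - b) ^- j / (z - a)).
Proof.
move=> as_ bs; have [->|ba] := eqVneq b a.
  apply: partial_fraction_eq (partial_fraction_term j as_) => z _.
  by rewrite exprSr invfM mulrC.
elim: j => [|j IH].
  apply: partial_fraction_eq (partial_fraction_inv as_) => z _.
  by rewrite expr0 invr1 mul1r.
apply: partial_fraction_eq (partial_fractionZ (b - a)^-1
  (partial_fractionD (partial_fraction_term j bs) (partial_fractionZ (-1) IH))) => z zs.
have za : z - a != 0 by rewrite subr_eq0; apply: contraNneq zs => ->.
have zb : z - b != 0 by rewrite subr_eq0; apply: contraNneq zs => ->.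
have ba' : b - a != 0 by rewrite subr_eq0.
rewrite (exprS _ j); have := expf_neq0 j zb; move: ((z - b) ^+ j) => y y0.
by field; rewrite y0 za zb ba'.
Qed.

Lemma partial_fraction_div s a f : a \in s -> partial_fraction s f ->
  partial_fraction s (fun z => f z / (z - a)).
Proof.
move=> as_ [P [L [sL fE]]].
have /factor_theorem[Q PE] : root (P - P.[a]%:P) a.
  by rewrite /root hornerD hornerN hornerC subrr.
have HP : partial_fraction s (fun z => Q.[z] + P.[a] * (z - a)^-1).
  apply: partial_fractionD (partial_fraction_poly _ _) _.
  exact: partial_fractionZ _ (partial_fraction_inv as_).
have HL : partial_fraction s (fun z => eval_terms L z / (z - a)).
  elim: L sL {fE} => [|t L IH] /=.
    move=> _; apply: partial_fraction_eq (partial_fraction_poly s 0) => z _.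
    by rewrite horner0 /eval_terms big_nil mul0r.
  move=> /andP[ts /IH HL].
  have Ht := partial_fraction_div_term t.2.+1 as_ ts.
  apply: partial_fraction_eq (partial_fractionD (partial_fractionZ t.1.1 Ht) HL).
  by move=> z _; rewrite /eval_terms big_cons mulrDl mulrA.
apply: partial_fraction_eq (partial_fractionD HP HL) => z zs.
have za : z - a != 0 by rewrite subr_eq0; apply: contraNneq zs => ->.
rewrite fE // mulrDl; congr (_ + _).
have -> : P.[z] = Q.[z] * (z - a) + P.[a].
  have := congr1 (horner^~ z) PE; rewrite hornerM hornerXsubC => <-.
  by rewrite hornerD hornerN hornerC subrK.
by rewrite mulrDl mulfK.
Qed.

Lemma partial_fractions s P :
  partial_fraction s (fun z => P.[z] / \prod_(a <- s) (z - a)).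
Proof.
(* The list of factors shrinks in the induction while the set of allowed poles stays fixed.
   Repetitions in [s] encode multiplicities. *)
suff H s' : {subset s' <= s} ->
    partial_fraction s (fun z => P.[z] / \prod_(a <- s') (z - a)).
  exact: H.
elim: s' => [|a s' IH] ss'.
  apply: partial_fraction_eq (partial_fraction_poly s P) => z _.
  by rewrite big_nil invr1 mulr1.
have as_ : a \in s by apply: ss'; rewrite mem_head.
have {}IH := IH (fun x xs => ss' x (mem_behead (s := a :: s') xs)).
apply: partial_fraction_eq (partial_fraction_div as_ IH) => z _.
by rewrite big_cons [_ * \prod_(_ <- _) _]mulrC invfM mulrA.
Qed.

End PartialFractions.

(** * Decay at infinity and the sum of the simple-pole coefficients *)

Section Decay.
Variable K : numFieldType.
Hypothesis harmonic0 : (n.+1%:R^-1 : K) @[n --> \oo] --> (0 : K).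

Lemma cvg_invX j : (n.+1%:R ^- j.+1 : K) @[n --> \oo] --> (0 : K).
Proof.
elim: j => [|j IH]; first by under eq_fun do rewrite expr1.
under eq_fun do rewrite exprS invfM.
by have H := cvgM harmonic0 IH; rewrite mulr0 in H; exact: H.
Qed.

(** Divided by n^(deg Q), with deg Q > 0, the values would tend both to 0 and to the leading
    coefficient. *)
Lemma poly_cvg_size (Q : {poly K}) (l : K) :
  Q.[n.+1%:R] @[n --> \oo] --> l -> (size Q <= 1)%N.
Proof.
move=> Ql; rewrite leqNgt; apply/negP => Q1.
have [d Qd] : exists d, size Q = d.+2 by case: (size Q) Q1 => [|[|d]] // _; exists d.
have : Q.[n.+1%:R] * n.+1%:R ^- d.+1 @[n --> \oo] --> l * 0.
  by apply: cvgM => //; exact: cvg_invX.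
have : Q.[n.+1%:R] * n.+1%:R ^- d.+1 @[n --> \oo] -->
   \sum_(i < d.+2) (Q`_i *+ (i == ord_max)).
  have -> : (fun n => Q.[n.+1%:R] * n.+1%:R ^- d.+1) =
      (fun n => \sum_(i < d.+2) Q`_i * n.+1%:R ^+ i * n.+1%:R ^- d.+1).
    by apply/funext => n; rewrite horner_coef Qd mulr_suml.
  apply: cvg_sum_seq => i; have [->|id] := eqVneq i ord_max.
    under eq_fun do rewrite mulfK ?expf_neq0 ?pnatr_eq0 //.
    exact: cvg_cst.
  have {id}id : (i < d.+1)%N by rewrite ltn_neqAle id -ltnS ltn_ord.
  have H : Q`_i * n.+1%:R ^- (d - i).+1 @[n --> \oo] --> Q`_i * 0.
    by apply: cvgM; [exact: cvg_cst|exact: cvg_invX].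
  rewrite mulr0n; rewrite mulr0 in H; apply: cvg_trans H; apply: near_eq_cvg.
  apply: nearW => n; rewrite -mulrA -subSn // -[in n.+1%:R ^- d.+1](subnKC (ltnW id)).
  by rewrite exprD invfM (mulrA (n.+1%:R ^+ i)) divff ?mul1r // expf_neq0 ?pnatr_eq0.
move=> /cvg_unique/[apply] => /(_ (@norm_hausdorff _ _)).
rewrite mulr0 (bigD1 ord_max) //= big1 => [|i /negbTE->]; last by rewrite mulr0n.
rewrite eqxx mulr1n addr0 => Qd0.
have : lead_coef Q == 0 by rewrite lead_coefE Qd /= Qd0.
by rewrite lead_coef_eq0 => /eqP Q0; rewrite Q0 size_poly0 in Qd.
Qed.

Lemma cvg_ratio b : n.+1%:R * (n.+1%:R - b)^-1 @[n --> \oo] --> (1 : K).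
Proof.
have H : (1 - b * n.+1%:R^-1)^-1 @[n --> \oo] --> (1 - b * 0)^-1.
  apply: cvgV; first by rewrite mulr0 subr0 oner_eq0.
  apply: cvgB; first exact: cvg_cst.
  by apply: cvgM => //; exact: cvg_cst.
rewrite mulr0 subr0 invr1 in H; apply: cvg_trans H; apply: near_eq_cvg.
apply: nearW => n; have n0 : n.+1%:R != 0 :> K by rewrite pnatr_eq0.
have -> : 1 - b * n.+1%:R^-1 = (n.+1%:R - b) / n.+1%:R by rewrite mulrBl divff.
by rewrite invfM invrK mulrC.
Qed.

Lemma cvg_term (c b : K) j : n.+1%:R * (c * (n.+1%:R - b) ^- j.+1) @[n --> \oo] -->
  c *+ (j == 0%N).
Proof.
have H i : n.+1%:R * (n.+1%:R - b) ^- i.+1 @[n --> \oo] --> ((i == 0%N)%:R : K).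
  elim: i => [|i IH]; first by under eq_fun do rewrite expr1; exact: cvg_ratio.
  have H : n.+1%:R * (n.+1%:R - b) ^- i.+1 * n.+1%:R^-1 *
      (n.+1%:R * (n.+1%:R - b)^-1) @[n --> \oo] --> ((i == 0%N)%:R * 0 * 1 : K).
    by apply: cvgM; [exact: cvgM|exact: cvg_ratio].
  rewrite mulr0 mul0r in H; rewrite [_%:R](_ : _ = 0) //.
  apply: cvg_trans H; apply: near_eq_cvg; apply: nearW => n /=.
  have n0 : n.+1%:R != 0 :> K by rewrite pnatr_eq0.
  rewrite (exprS _ i.+1) invfM; set y := (_ - _)^-1; set w := _ ^- _.
  by move: (n.+1%:R) n0 y w => x x0 y w; field.
under eq_fun do rewrite mulrCA.
rewrite -mulr_natr; apply: cvgM; [exact: cvg_cst|exact: H].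
Qed.

(** Along the integers n f(n) tends to 0, while n times the sum of the polar terms tends to the sum
    S of the simple-pole coefficients. So n P(n) tends to - S, which forces ['X * P] to be constant,
    hence P = 0 and then S = 0. *)
Lemma partial_fraction_decay (s : seq K) (f : K -> K) (M : K) : partial_fraction s f ->
  (forall n, n.+1%:R \notin s) -> (forall n, `|f n.+1%:R| <= M * n.+1%:R ^- 2) ->
  exists L, [/\ all (fun t => t.1.2 \in s) L,
    forall z, z \notin s -> f z = eval_terms L z &
    \sum_(t <- L) t.1.1 *+ (t.2 == 0%N) = 0].
Proof.
move=> [P [L [sL fE]]] ns fM; exists L.
have f0 : n.+1%:R * f n.+1%:R @[n --> \oo] --> (0 : K).
  apply/cvgrPdist_lt => e e0.
  have /cvgrPdist_lt/(_ e e0) : M * n.+1%:R^-1 @[n --> \oo] --> M * 0.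
    by apply: cvgM => //; exact: cvg_cst.
  apply: filterS => n; rewrite mulr0 !sub0r !normrN; apply: le_lt_trans.
  have M0 : 0 <= M * n.+1%:R^-1.
    have := le_trans (normr_ge0 _) (fM n); rewrite -exprVn expr2 mulrA.
    by rewrite pmulr_lge0 // invr_gt0.
  rewrite (ger0_norm M0) normrM normr_nat mulrC -ler_pdivlMr //.
  by rewrite -mulrA -expr2 exprVn.
set S := \sum_(t <- L) _.
have HS : n.+1%:R * eval_terms L n.+1%:R @[n --> \oo] --> S.
  under eq_fun do rewrite mulr_sumr.
  by apply: cvg_sum_seq => t; exact: cvg_term.
have HP : ('X * P).[n.+1%:R] @[n --> \oo] --> 0 - S.
  have H : n.+1%:R * f n.+1%:R - n.+1%:R * eval_terms L n.+1%:R
      @[n --> \oo] --> 0 - S by apply: cvgB.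
  apply: cvg_trans H; apply: near_eq_cvg; apply: nearW => n /=.
  by rewrite fE // hornerM hornerX; ring.
have P0 : P = 0.
  apply/eqP/negPn/negP => P0; have := poly_cvg_size HP.
  by rewrite mulrC size_mulX // ltnS leqn0 size_poly_eq0 (negbTE P0).
split=> // [z zs|]; first by rewrite fE // P0 horner0 add0r.
apply/eqP; rewrite -oppr_eq0 -sub0r; apply/eqP.
move: HP; rewrite P0 mulr0; under eq_fun do rewrite horner0.
by move=> /cvg_unique => /(_ (@norm_hausdorff _ _)); apply; exact: cvg_cst.
Qed.

End Decay.

(** * Summation of the residues *)

Section Assembly.
Variable K : numFieldType.
Local Notation H := (harmonic_number K).

Lemma harmonic_gap m k : 0 <= H (m + k) - H m <= k%:R / m.+1%:R.
Proof.
elim: k => [|k /andP[IH0 IH1]]; first by rewrite addn0 subrr mul0r lexx.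
rewrite addnS harmonic_numberS addrAC; apply/andP; split.
  by rewrite addr_ge0 // invr_ge0.
rewrite -[k.+1%:R]natr1 mulrDl mul1r; apply: lerD => //.
by rewrite lef_pV2 ?posrE // ler_nat ltnS leq_addr.
Qed.

Lemma sum_inv_conv N :
  \sum_(n < N) (n.+1%:R * (N - n)%:R)^-1 = 2 * (H N / N.+1%:R) :> K.
Proof.
have n1 n : n.+1%:R != 0 :> K by rewrite pnatr_eq0.
have -> : \sum_(n < N) (n.+1%:R * (N - n)%:R)^-1 =
    \sum_(n < N) (n.+1%:R^-1 + (N - n)%:R^-1) / N.+1%:R :> K.
  apply: eq_bigr => -[n /= nN] _.
  have e : N.+1%:R = n.+1%:R + (N - n)%:R :> K.
    by rewrite -natrD addSn subnKC // ltnW.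
  have m0 : (N - n)%:R != 0 :> K by rewrite pnatr_eq0 subn_eq0 -ltnNge.
  have := n1 N; rewrite e; move: (n.+1%:R : K) ((N - n)%:R : K) (n1 n) m0.
  by move=> x y x0 y0 xy0; field; rewrite x0 y0 xy0.
rewrite -mulr_suml big_split /= sum_inv_harmonic.
have -> : \sum_(n < N) (N - n)%:R^-1 = H N.
  rewrite -sum_inv_harmonic (reindex_inj rev_ord_inj) /=.
  by apply: eq_bigr => -[n /= nN] _; rewrite subKn.
by rewrite mulrA mulr_natl mulr2n.
Qed.

Hypothesis harmonic_mean0 : H N / N.+1%:R @[N --> \oo] --> (0 : K).

(** The gap H_N - H_(N-n-1) has n + 1 terms, each at most 1/(N - n). Against the decay of [f] this
    leaves M / ((n + 1) (N - n)), which [sum_inv_conv] sums to 2 M H_N / (N + 1). *)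
Lemma error_cvg0 (f : nat -> K) (M : K) :
  (forall n, `|f n| <= M * n.+1%:R ^- 2) ->
  \sum_(n < N) f n * (H N - H (N - n.+1)) @[N --> \oo] --> (0 : K).
Proof.
move=> fM.
have M0 : 0 <= M.
  by have := le_trans (normr_ge0 _) (fM 0); rewrite expr1n invr1 mulr1.
have B N : `|\sum_(n < N) f n * (H N - H (N - n.+1))| <= M * (2 * (H N / N.+1%:R)).
  rewrite -sum_inv_conv mulr_sumr; apply: le_trans (ler_norm_sum _ _ _) _.
  apply: ler_sum => -[n /= nN] _; rewrite normrM.
  have /andP[g0 g1] := harmonic_gap (N - n.+1) n.+1.
  rewrite subnK // in g0 g1; rewrite (ger0_norm g0).
  have -> : M * (n.+1%:R * (N - n)%:R)^-1 =
      M * n.+1%:R ^- 2 * (n.+1%:R / (N - n)%:R).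
    have n0 : n.+1%:R != 0 :> K by rewrite pnatr_eq0.
    have m0 : (N - n)%:R != 0 :> K by rewrite pnatr_eq0 subn_eq0 -ltnNge.
    by move: (n.+1%:R : K) ((N - n)%:R : K) n0 m0 => x y x0 y0; field; rewrite x0 y0.
  by apply: ler_pM => //; move: g1; rewrite -subSn // subSS.
apply/cvgrPdist_lt => e e0.
have /cvgrPdist_lt/(_ e e0) : M * (2 * (H N / N.+1%:R)) @[N --> \oo] --> M * (2 * 0).
  by apply: cvgM; [exact: cvg_cst|apply: cvgM => //; exact: cvg_cst].
apply: filterS => n; rewrite !mulr0 !sub0r !normrN; apply: le_lt_trans.
by rewrite (ger0_norm (le_trans (normr_ge0 _) (B n))).
Qed.

Lemma cvg_harmonic_sum (s : seq K) (L : seq (K * K * nat)) (f : nat -> K) (M : K)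
    (l : K -> K * K * nat -> K) : uniq s ->
  all (fun t => t.1.2 \in s) L ->
  (forall n, f n = eval_terms L n.+1%:R) ->
  (forall n, `|f n| <= M * n.+1%:R ^- 2) ->
  \sum_(t <- L) t.1.1 *+ (t.2 == 0%N) = 0 ->
  (forall a t, a \in s -> (if a == t.1.2 then - square_coef a N t.2 else 0)
     @[N --> \oo] --> l a t) ->
  \sum_(n < N) f n * H n.+1 @[N --> \oo] -->
  2^-1 * \sum_(a <- s) \sum_(t <- L) t.1.1 * l a t.
Proof.
move=> us sL fE fM S0 Hl.
have E N : \sum_(a <- s) \sum_(t <- L)
     t.1.1 * (if a == t.1.2 then - square_coef a N t.2 else 0) =
   2 * \sum_(n < N) weight K N n * f n.
  rewrite exchange_big /=.
  transitivity (\sum_(t <- L) t.1.1 * - square_coef t.1.2 N t.2).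
    apply: eq_big_seq => t /(allP sL) ts.
    rewrite (bigD1_seq t.1.2) //= eqxx big1 ?addr0 // => a /negbTE->.
    by rewrite mulr0.
  (* [H N ^+ 2] occurs in coefficient 0 only, so it meets exactly the simple-pole terms, whose
     coefficients add up to 0 by [S0]. *)
  transitivity (- (H N ^+ 2 * \sum_(t <- L) t.1.1 *+ (t.2 == 0%N)) +
    2 * \sum_(t <- L) \sum_(n < N) weight K N n *
       (t.1.1 * (n.+1%:R - t.1.2) ^- t.2.+1)).
    rewrite !mulr_sumr -sumrN -big_split; apply: eq_bigr => t _ /=.
    rewrite /square_coef opprD mulrDr mulNr opprK mulrN; congr (- _ + _).
      by rewrite !mulrnAr mulrC.
    by rewrite mulrCA mulr_sumr; congr (_ * _); apply: eq_bigr => n _; rewrite mulrCA.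
  rewrite S0 mulr0 oppr0 add0r exchange_big; congr (_ * _).
  by apply: eq_bigr => n _; rewrite -mulr_sumr fE.
have Hw : \sum_(n < N) weight K N n * f n @[N --> \oo] -->
    2^-1 * \sum_(a <- s) \sum_(t <- L) t.1.1 * l a t.
  have -> : (fun N => \sum_(n < N) weight K N n * f n) = (fun N => 2^-1 *
      \sum_(a <- s) \sum_(t <- L)
      t.1.1 * (if a == t.1.2 then - square_coef a N t.2 else 0)).
    by apply/funext => N; rewrite E mulKf // pnatr_eq0.
  apply: cvgM; first exact: cvg_cst.
  rewrite big_seq; under eq_fun do rewrite big_seq.
  apply: cvg_big => //; first exact: add_continuous.
  move=> a as_; apply: cvg_sum_seq => t; apply: cvgM; first exact: cvg_cst.
  exact: Hl.
rewrite -[2^-1 * _]subr0.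
have -> : (fun N => \sum_(n < N) f n * H n.+1) =
  (fun N => \sum_(n < N) weight K N n * f n -
            \sum_(n < N) f n * (H N - H (N - n.+1))).
  apply/funext => N /=; rewrite -sumrB; apply: eq_bigr => n _.
  by rewrite /weight; ring.
by apply: cvgB => //; exact: error_cvg0 fM.
Qed.

End Assembly.

(** * The Gamma and digamma functions *)

Section ComplexTopology.
Variable R : realType.
Local Notation C := (R[i] : numFieldType).

Lemma normCR (x : R) : `|x%:C| = `|x|%:C.
Proof. by rewrite normc_def /= expr0n addr0 sqrtr_sqr. Qed.

Lemma gt0C_real (e : R[i]) : 0 < e -> exists2 r : R, 0 < r & e = r%:C.
Proof.
move=> e0; have er : e = (complex.Re e)%:C by rewrite RRe_real // gtr0_real.
by exists (complex.Re e) => //; rewrite -ltcR -er.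
Qed.

Lemma ge0C_real (e : R[i]) : 0 <= e -> exists2 r : R, 0 <= r & e = r%:C.
Proof.
move=> e0; have er : e = (complex.Re e)%:C by rewrite RRe_real // ger0_real.
by exists (complex.Re e) => //; rewrite -lecR -er.
Qed.

Lemma natCR n : (n%:R : R[i]) = (n%:R : R)%:C.
Proof. by rewrite rmorph_nat. Qed.

Lemma cvg_realC (x : nat -> R) (l : R) : x n @[n --> \oo] --> l ->
  ((x n)%:C : C) @[n --> \oo] --> (l%:C : C).
Proof.
move=> /cvgrPdist_lt xl; apply/cvgrPdist_lt => e /gt0C_real[r r0 ->].
have := xl r r0; apply: filterS => n.
by rewrite -rmorphB /= normCR ltcR.
Qed.

Lemma normc_ge_Im (z : R[i]) : `|complex.Im z|%:C <= `|z|.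
Proof.
rewrite normc_def lecR -sqrtr_sqr ler_sqrt; first by rewrite lerDr sqr_ge0.
by rewrite addr_ge0 // sqr_ge0.
Qed.

Lemma inv_sq_series_cvg (t : nat -> R) (M : R) :
  (forall n, `|t n| <= M * n.+1%:R ^- 2) -> cvgn (series t).
Proof.
move=> tM; have M0 : 0 <= M.
  by have := le_trans (normr_ge0 _) (tM 0%N); rewrite expr1n invr1 mulr1.
apply: normed_cvg; rewrite /=.
apply: nondecreasing_is_cvgn.
  by apply: (@nondecreasing_series _ (fun n => `|t n|) xpredT) => n _.
exists (M * 2) => _ [N _ <-]; rewrite /= /series /= big_mkord.
apply: (@le_trans _ _ (\sum_(n < N) M * n.+1%:R ^- 2)).
  by apply: ler_sum => n _; exact: tM.
by rewrite -mulr_sumr ler_wpM2l // sum_inv_sq_le2.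
Qed.

Lemma inv_sq_completeC : inv_sq_complete C.
Proof.
move=> t M0 tM0.
have : 0 <= M0.
  by have := le_trans (normr_ge0 _) (tM0 0%N); rewrite expr1n invr1 mulr1.
move=> /ge0C_real[M _ M0E]; rewrite {}M0E in tM0.
have {tM0}tM n : `|t n| <= (M * n.+1%:R ^- 2)%:C.
  by rewrite rmorphM /= fmorphV rmorphXn rmorph_nat.
have Re_cvg : cvgn (series (fun n => complex.Re (t n))).
  apply: (@inv_sq_series_cvg _ M) => n; rewrite -lecR.
  exact: le_trans (normc_ge_Re _) (tM n).
have Im_cvg : cvgn (series (fun n => complex.Im (t n))).
  apply: (@inv_sq_series_cvg _ M) => n; rewrite -lecR.
  exact: le_trans (normc_ge_Im _) (tM n).
exists ((limn (series (fun n => complex.Re (t n))))%:C +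
  'i%C * (limn (series (fun n => complex.Im (t n))))%:C).
have -> : (fun N => \sum_(n < N) t n) = (fun N =>
   (series (fun n => complex.Re (t n)) N)%:C +
   'i%C * (series (fun n => complex.Im (t n)) N)%:C).
  apply/funext => N; rewrite /series /= !big_mkord !rmorph_sum /= mulr_sumr -big_split.
  by apply: eq_bigr => n _; exact: complexE.
apply: cvgD; first exact: cvg_realC.
by apply: cvgM; [exact: cvg_cst|exact: cvg_realC].
Qed.

Lemma harmonic0C : (n.+1%:R^-1 : C) @[n --> \oo] --> (0 : C).
Proof.
have -> : (fun n => n.+1%:R^-1 : C) = fun n => ((n.+1%:R^-1 : R)%:C : C).
  by apply/funext => n; rewrite natCR fmorphV.
by apply: cvg_realC; exact: cvg_harmonic.
Qed.

Lemma harmonic_numberC n : harmonic_number R[i] n = (harmonic_number R n)%:C.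
Proof.
rewrite /harmonic_number /series /= rmorph_sum; apply: eq_bigr => i _.
by rewrite /= natCR fmorphV.
Qed.

Lemma harmonic_mean0C :
  (harmonic_number R[i] N / N.+1%:R : C) @[N --> \oo] --> (0 : C).
Proof.
have -> : (fun N => harmonic_number R[i] N / N.+1%:R : C) =
    fun N => ((harmonic_number R N / N.+1%:R : R)%:C : C).
  by apply/funext => N; rewrite natCR harmonic_numberC -fmorphV -rmorphM.
apply: cvg_realC.
have H0 := @cvg_harmonic R.
(* By Cesaro the mean H_(N+1) / (N + 1) tends to 0; subtracting 1/(N + 1)^2 leaves H_N / (N + 1). *)
have H : arithmetic_mean (@harmonic R) N - harmonic N * harmonic N
    @[N --> \oo] --> (0 - 0 * 0 : R).
  by apply: cvgB; [exact: cesaro|exact: cvgM].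
rewrite mulr0 subr0 in H; apply: cvg_trans H.
apply: near_eq_cvg; apply: nearW => N /=.
rewrite /arithmetic_mean /= -/(harmonic_number R _) harmonic_numberS; ring.
Qed.

End ComplexTopology.

(** * Second-order estimates for the exponential and the logarithm *)

Section ComplexExp.
Variable R : realType.
Implicit Types (x y : R) (w z : R[i]).

Lemma sin_le_norm y : `|sin y| <= `|y|.
Proof.
suff H x : 0 < x -> `|sin x| <= x.
  have [y0|y0|->] := ltgtP y 0; last by rewrite sin0.
    by rewrite (ltr0_norm y0) -normrN -sinN H // oppr_gt0.
  by rewrite (gtr0_norm y0) H.
move=> x0; have [|c _] := @MVT R sin cos 0 x x0 (fun t _ => is_derive_sin t).
  by apply: continuous_subspaceT => t; exact: continuous_sin.
rewrite sin0 !subr0 => ->; rewrite normrM (gtr0_norm x0).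
by rewrite ler_piMl ?cos_max // ltW.
Qed.

Lemma cos_sub1_le y : `|cos y - 1| <= y ^+ 2.
Proof.
suff H x : 0 < x -> `|cos x - 1| <= x ^+ 2.
  have [y0|y0|->] := ltgtP y 0; last by rewrite cos0 subrr normr0 expr0n.
    by rewrite -cosN -sqrrN H // oppr_gt0.
  by rewrite H.
move=> x0.
have [|c cx] := @MVT R cos (fun t => - sin t) 0 x x0 (fun t _ => is_derive_cos t).
  by apply: continuous_subspaceT => t; exact: continuous_cos.
rewrite cos0 !subr0 => ->; rewrite normrM (gtr0_norm x0) normrN expr2.
rewrite ler_wpM2r ?(ltW x0) //; apply: le_trans (sin_le_norm c) _.
by move: cx; rewrite in_itv /= => /andP[c0 cx]; rewrite gtr0_norm // ltW.
Qed.

Lemma sin_sub_le y : `|y| <= 1 -> `|sin y - y| <= y ^+ 2.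
Proof.
suff H x : 0 < x -> x <= 1 -> `|sin x - x| <= x ^+ 2.
  have [y0|y0|->] := ltgtP y 0; last by rewrite sin0 subrr normr0 expr0n.
    rewrite (ltr0_norm y0) => y1; rewrite -normrN opprD -sinN -sqrrN H //.
    by rewrite oppr_gt0.
  by rewrite (gtr0_norm y0) => y1; rewrite H.
move=> x0 x1; have [|c cx] := @MVT R sin cos 0 x x0 (fun t _ => is_derive_sin t).
  by apply: continuous_subspaceT => t; exact: continuous_sin.
rewrite sin0 !subr0 => ->; rewrite -{2}[x]mul1r -mulrBl normrM (gtr0_norm x0) expr2.
rewrite ler_wpM2r ?(ltW x0) //; apply: le_trans (cos_sub1_le c) _.
move: cx; rewrite in_itv /= => /andP[c0 cx]; nra.
Qed.

(** Both sides come from exp t >= 1 + t: at t = x it gives the sign, at t = - x it gives (1 - x) exp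
    x <= 1. *)
Lemma expR_sub_le x : `|x| <= 2^-1 -> `|expR x - 1 - x| <= 2 * x ^+ 2.
Proof.
move=> xh; have := expR_ge1Dx x; have := expR_ge1Dx (- x).
rewrite expRN => h1 h2; have e0 := expR_gt0 x.
have xb : - 2^-1 <= x <= 2^-1 by rewrite -ler_norml.
have h3 : (1 - x) * expR x <= 1 by rewrite -ler_pdivlMr // mul1r.
rewrite ger0_norm; last by lra.
by move: (expR x) h1 h2 e0 h3 => e h1 h2 e0 h3; nra.
Qed.

Lemma cexpD z w : cexp (z + w) = cexp z * cexp w.
Proof.
case: z w => [a b] [c d]; rewrite /cexp /=.
rewrite expRD cosD sinD; apply/eqP; rewrite eq_complex /=.
by apply/andP; split; apply/eqP; ring.
Qed.

Lemma cexp0 : cexp 0 = 1 :> R[i].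
Proof. by rewrite /cexp /= expR0 cos0 sin0 mul1r. Qed.

Lemma cexp_real x : cexp x%:C = (expR x)%:C.
Proof. by rewrite /cexp /= cos0 sin0 mulr1. Qed.

Lemma cexp_neq0 z : cexp z != 0.
Proof.
apply/eqP => z0; have := cexpD z (- z); rewrite subrr cexp0 z0 mul0r.
by move/eqP; rewrite oner_eq0.
Qed.

Lemma norm_complex_le x y : `|x +i* y| <= (`|x| + `|y|)%:C.
Proof.
rewrite normc_def /= lecR -[leRHS]ger0_norm ?addr_ge0 // -sqrtr_sqr.
rewrite ler_sqrt ?sqr_ge0 //.
have := normr_ge0 x; have := normr_ge0 y; rewrite -[x ^+ 2]real_normK ?num_real //.
by rewrite -[y ^+ 2]real_normK ?num_real //; nra.
Qed.

Lemma cexp_sub_le w : `|w| <= 2^-1 -> `|cexp w - 1 - w| <= 8 * `|w| ^+ 2.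
Proof.
case: w => x y wh.
have h2C : (2^-1 : R[i]) = (2^-1 : R)%:C by rewrite fmorphV rmorph_nat.
have xh : `|x| <= 2^-1.
  by rewrite -lecR -h2C; apply: le_trans wh; exact: (normc_ge_Re (x +i* y)).
have yh : `|y| <= 2^-1.
  by rewrite -lecR -h2C; apply: le_trans wh; exact: (normc_ge_Im (x +i* y)).
have -> : cexp (x +i* y) - 1 - (x +i* y) =
    (expR x * cos y - 1 - x) +i* (expR x * sin y - y).
  by apply/eqP; rewrite eq_complex /=; apply/andP; split; apply/eqP; ring.
apply: le_trans (norm_complex_le _ _) _.
rewrite -add_Re2_Im2 /= -[8]/(8%:R) -(rmorph_nat (real_complex R)) -rmorphM lecR.
have := expR_sub_le xh; have := cos_sub1_le y; have y1 : `|y| <= 1 by lra.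
have := sin_sub_le y1; have := sin_le_norm y; have := cos_max y.
move: (expR x) (cos y) (sin y) => e c s c1 sy sy2 cy ex.
have -> : e * c - 1 - x = (e - 1 - x) * c + (1 + x) * (c - 1) by ring.
have -> : e * s - y = (e - 1 - x + x) * s + (s - y) by ring.
have x1 : `|1 + x| <= 2.
  by apply: le_trans (ler_normD _ _) _; rewrite normr1; lra.
have X2 := real_normK (num_real x); have Y2 := real_normK (num_real y).
have B1 : `|(e - 1 - x) * c + (1 + x) * (c - 1)| <= 2 * x ^+ 2 + 2 * y ^+ 2.
  apply: le_trans (ler_normD _ _) _; rewrite !normrM; apply: lerD.
    by rewrite -[leRHS]mulr1 ler_pM.
  by rewrite ler_pM.
have B2 : `|(e - 1 - x + x) * s + (s - y)| <= 2 * `|x| * `|y| + y ^+ 2.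
  apply: le_trans (ler_normD _ _) _; rewrite normrM; apply: lerD => //.
  apply: ler_pM => //; apply: le_trans (ler_normD _ _) _.
  have := normr_ge0 x; nra.
apply: le_trans (lerD B1 B2) _; rewrite -X2 -Y2.
by have := normr_ge0 x; have := normr_ge0 y; nra.
Qed.

(* As [ln 0 = 0], these telescope to [ln n] even from [k = 0]. *)
Definition ln_step k : R := ln k%:R - ln k.-1%:R.

Lemma sum_ln_step n : \sum_(k < n.+1) ln_step k = ln n%:R.
Proof.
elim: n => [|n IH]; first by rewrite big_ord1 /ln_step subrr ln0.
by rewrite big_ord_recr /= IH /ln_step addrC subrK.
Qed.

(** For k >= 2 the step lies between 1/k and 1/(k - 1). With x = k - 1, the constant 6 is what makes
    1/x - 1/(x + 2) <= 6/(x + 2)^2 true from x = 1 on. For k = 0 and k = 1 the step is 0, as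
    [ln 0 = 0]. *)
Lemma ln_step_bound k : `|ln_step k - k.+1%:R^-1| <= 6 * k.+1%:R ^- 2.
Proof.
case: k => [|[|k]].
- by rewrite /ln_step subrr sub0r normrN !invr1 normr1 expr1n invr1; lra.
- by rewrite /ln_step ln1 ln0 // subrr sub0r normrN ger0_norm ?invr_ge0 //; lra.
rewrite /ln_step /=; have k1 : 1 <= k.+1%:R :> R by rewrite ler1n.
have -> : k.+3%:R = k.+1%:R + 2 :> R by rewrite -[k.+3]addn2 natrD.
have -> : k.+2%:R = k.+1%:R + 1 :> R by rewrite -[k.+2]addn1 natrD.
move: (k.+1%:R) k1 => x x1'; have x0 : 0 < x by lra.
have x1 : 0 < x + 1 by lra.
have u : ln (x + 1) - ln x <= x^-1.
  rewrite -ln_div ?posrE //; have -> : (x + 1) / x = 1 + x^-1.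
    by rewrite mulrDl divff ?mul1r // gt_eqF.
  by apply: le_ln1Dx; rewrite (lt_trans (ltrN10 _)) // invr_gt0.
have l : (x + 1)^-1 <= ln (x + 1) - ln x.
  rewrite -lerN2 opprB -ln_div ?posrE //; have -> : x / (x + 1) = 1 + - (x + 1)^-1.
    by apply: (mulIf (lt0r_neq0 x1)); rewrite mulrDl mulNr mulVf ?divfK ?gt_eqF //; ring.
  apply: le_ln1Dx; rewrite ltrN2 invf_lt1 //; lra.
have e1 : (x + 2)^-1 <= (x + 1)^-1 by rewrite lef_pV2 ?posrE //; lra.
rewrite ger0_norm; last by lra.
apply: (@le_trans _ _ (x^-1 - (x + 2)^-1)); first by lra.
have x2 : 0 < x + 2 by lra.
rewrite -subr_ge0; have -> : 6 * (x + 2) ^- 2 - (x^-1 - (x + 2)^-1) =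
    (4 * x - 4) / (x * (x + 2) ^+ 2) by field; rewrite !gt_eqF.
by rewrite divr_ge0 ?mulr_ge0 ?exprn_ge0 ?(ltW x0) ?(ltW x2) //; lra.
Qed.

End ComplexExp.

(** * Infinite products with factors 1 + O(n^-2) *)

Section Products.
Variable K : numFieldType.
Implicit Types (x u : nat -> K).

(** The bounds depend on the number of factors through [S n] alone, which makes the expansion of the
    Gamma quotient uniform in [n]. *)
Lemma prod_sub_le x n (S := fun n => \sum_(k < n) `|x k|) : S n <= 2^-1 ->
  `|\prod_(k < n) (1 + x k) - 1| <= 2 * S n /\
  `|\prod_(k < n) (1 + x k) - 1 - \sum_(k < n) x k| <= 2 * S n ^+ 2.
Proof.
elim: n => [|n IH].
  rewrite /S !big_ord0 subrr normr0 mulr0 => _; split=> //.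
  by rewrite subr0 normr0 expr0n mulr0.
have SS : S n.+1 = S n + `|x n| by rewrite /S big_ord_recr.
rewrite SS => Sh; have S0 : 0 <= S n by apply: sumr_ge0.
have [|H1 H2] := IH; first by apply: le_trans Sh; rewrite lerDl.
rewrite !big_ord_recr /=; set P := \prod_(k < n) _ in H1 H2 *.
set T := \sum_(k < n) _ in H2 *.
split.
  have -> : P * (1 + x n) - 1 = (P - 1) + (P - 1) * x n + x n by ring.
  apply: le_trans (ler_normD _ _) _; apply: le_trans (lerD (ler_normD _ _) (lexx _)) _.
  rewrite normrM mulrDr -addrA; apply: lerD => //.
  have -> : 2 * `|x n| = `|x n| + `|x n| by ring.
  rewrite lerD2r ler_piMl //; apply: le_trans H1 _.
  rewrite -ler_pdivlMl // mulr1; apply: le_trans Sh; by rewrite lerDl.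
have -> : P * (1 + x n) - 1 - (T + x n) = (P - 1 - T) + (P - 1) * x n by ring.
apply: le_trans (ler_normD _ _) _.
apply: (@le_trans _ _ (2 * S n ^+ 2 + 2 * S n * `|x n|)).
  by apply: lerD => //; rewrite normrM ler_wpM2r.
have -> : 2 * (S n + `|x n|) ^+ 2 =
  2 * S n ^+ 2 + 2 * S n * `|x n| + 2 * (S n * `|x n| + `|x n| ^+ 2) by ring.
by rewrite lerDl mulr_ge0 // addr_ge0 ?mulr_ge0 ?exprn_ge0.
Qed.

Lemma bounded_shift u N (M : K) : (forall n, `|u (n + N)%N| <= M) ->
  exists M' : K, forall n, `|u n| <= M'.
Proof.
move=> uM; exists (M + \sum_(k < N) `|u k|) => n.
have M0 : 0 <= M := le_trans (normr_ge0 _) (uM 0%N).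
have [Nn|nN] := leqP N n.
  rewrite -(subnK Nn); apply: le_trans (uM _) _.
  by rewrite lerDl sumr_ge0.
rewrite (bigD1 (Ordinal nN)) //= addrCA lerDl.
by apply: addr_ge0 => //; apply: sumr_ge0.
Qed.

Lemma cvg_norm_bounded u (l : K) : u n @[n --> \oo] --> l ->
  exists M : K, forall n, `|u n| <= M.
Proof.
move=> /cvgrPdist_lt/(_ 1 ltr01)[N _ HN].
apply: (@bounded_shift u N (`|l| + 1)) => n.
have := HN (n + N)%N (leq_addl _ _) => /= lu.
rewrite -[u _](subrK l) addrC; apply: le_trans (ler_normD _ _) _.
by rewrite lerD2l distrC ltW.
Qed.

Hypothesis harmonic0 : (n.+1%:R^-1 : K) @[n --> \oo] --> (0 : K).
Hypothesis complete : inv_sq_complete K.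

Lemma ratio_bounded (b : K) : exists2 A : K, 0 < A &
  forall n, `|n.+1%:R / (n.+1%:R - b)| <= A.
Proof.
have [M HM] := cvg_norm_bounded (cvg_ratio harmonic0 b).
exists (M + 1) => [|n]; last by apply: le_trans (HM n) _; rewrite lerDl.
by rewrite ltr_wpDl // (le_trans _ (HM 0%N)).
Qed.

(** The ratio (n + 1)/(n + 1 - a) tends to 1, hence is bounded; [delta] is the inverse of a
    bound. *)
Lemma away_exists (a : K) : (forall n, n.+1%:R != a) ->
  exists2 delta, 0 < delta & forall n, delta * n.+1%:R <= `|n.+1%:R - a|.
Proof.
move=> na; have [A A0 HA] := ratio_bounded a.
exists A^-1 => [|n]; first by rewrite invr_gt0.
have := HA n; rewrite normrM normfV normr_nat ler_pdivrMr; last first.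
  by rewrite normr_gt0 subr_eq0.
by rewrite ler_pdivrMl.
Qed.

(** No logarithm is taken. A tail with absolute sum at most 1/4 has partial products Q_n within 1/2
    of 1, so its limit is not 0; it converges since Q_n = 1 + sum Q_k y_k has terms O(k^-2). The
    shift [N] allows for bounds valid only eventually. *)
Lemma prod_cvg x (M : K) (N : nat) :
  (forall n, `|x (n + N)%N| <= M * n.+1%:R ^- 2) -> (forall n, 1 + x n != 0) ->
  exists2 l : K, l != 0 & \prod_(k < n) (1 + x k) @[n --> \oo] --> l.
Proof.
move=> xM x0.
have M0 : 0 <= M.
  by have := le_trans (normr_ge0 _) (xM 0%N); rewrite expr1n invr1 mulr1.
have [p Hp] : exists p, M * p.+1%:R^-1 <= 4^-1.
  have /cvgrPdist_lt : M * n.+1%:R^-1 @[n --> \oo] --> M * 0.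
    by apply: cvgM => //; exact: cvg_cst.
  have e0 : 0 < 4^-1 :> K by rewrite invr_gt0.
  move=> /(_ _ e0)[p _ /(_ p (leqnn p))] /=.
  rewrite mulr0 sub0r normrN ger0_norm ?mulr_ge0 ?invr_ge0 // => /ltW.
  by exists p.
pose q := (p.+1 + N)%N; pose y k := x (k + q)%N.
have yM k : `|y k| <= M * (k + p.+1).+1%:R ^- 2 by rewrite /y /q addnA; exact: xM.
have Sh n : \sum_(k < n) `|y k| <= 4^-1.
  apply: le_trans Hp; apply: (@le_trans _ _ (\sum_(k < n) M * (k + p.+1).+1%:R ^- 2)).
    by apply: ler_sum => k _; exact: yM.
  rewrite -mulr_sumr ler_wpM2l //; apply: le_trans (sum_inv_sq _ _ (ltn0Sn p)) _.
  by rewrite lerBlDr lerDl invr_ge0.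
pose Q n := \prod_(k < n) (1 + y k).
have Q1 n : `|Q n - 1| <= 2^-1.
  have [|H _] := @prod_sub_le y n.
    apply: le_trans (Sh n) _; rewrite lef_pV2 ?posrE //; exact: ler_nat.
  apply: le_trans H _; have -> : 2^-1 = 2 * 4^-1 :> K by field.
  by rewrite ler_wpM2l.
have [l Hl] : exists l : K, \sum_(n < m) (Q n * y n) @[m --> \oo] --> l.
  apply: (@complete (fun n => Q n * y n) (2 * M)) => n.
  rewrite normrM -mulrA; apply: ler_pM => //.
    rewrite -[Q n](subrK 1); apply: le_trans (ler_normD _ _) _.
    rewrite normr1 -[2]/(1 + 1) lerD2r; apply: le_trans (Q1 n) _.
    by rewrite invf_le1 // ler1n.
  apply: le_trans (yM n) _; rewrite ler_wpM2l // lef_pV2 ?posrE ?exprn_gt0 //.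
  by rewrite lerXn2r ?nnegrE // ler_nat ltnS leq_addr.
have QE n : Q n = 1 + \sum_(k < n) (Q k * y k).
  elim: n => [|n IH]; first by rewrite /Q !big_ord0 addr0.
  by rewrite big_ord_recr addrA -IH /Q big_ord_recr /= mulrDr mulr1.
have Qcvg : Q n @[n --> \oo] --> 1 + l.
  have -> : Q = fun n => 1 + \sum_(k < n) (Q k * y k) by apply/funext.
  by apply: cvgD => //; exact: cvg_cst.
have l0 : 1 + l != 0.
  apply/eqP => l0; rewrite l0 in Qcvg.
  have H : Q n - 1 @[n --> \oo] --> (0 - 1 : K).
    by apply: cvgB => //; exact: cvg_cst.
  have := cvg_norm_le H Q1.
  by rewrite sub0r normrN normr1 lt_geF // invf_lt1 // ltr1n.
exists (\prod_(k < q) (1 + x k) * (1 + l)).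
  by rewrite mulf_neq0 //; apply/prodf_neq0 => k _.
rewrite -(cvg_shiftn q).
have -> : [sequence \prod_(k < n + q) (1 + x k)]_n =
    (fun n => \prod_(k < q) (1 + x k) * Q n).
  apply/funext => n /=; rewrite addnC big_split_ord /=; congr (_ * _).
  by apply: eq_bigr => k _; rewrite /y addnC.
by apply: cvgM => //; exact: cvg_cst.
Qed.

End Products.

Lemma limit_ratio_bound (K : numFieldType) (u v s : nat -> K) (U V d h B : K) :
  U != 0 -> u n @[n --> \oo] --> U -> v n @[n --> \oo] --> V ->
  s n @[n --> \oo] --> d -> (forall n, `|v n / u n - 1 - h * s n| <= B) ->
  `|V - U - h * d * U| <= `|U| * B.
Proof.
move=> U0 uU vV sd HB.
have H : v n / u n - 1 - h * s n @[n --> \oo] --> V / U - 1 - h * d.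
  apply: cvgB; last by apply: cvgM => //; exact: cvg_cst.
  apply: cvgB; last exact: cvg_cst.
  by apply: cvgM => //; exact: cvgV.
have -> : V - U - h * d * U = U * (V / U - 1 - h * d) by field.
by rewrite normrM ler_wpM2l // (cvg_norm_le H HB).
Qed.

Lemma derive1_quadratic (K : numFieldType) (f : K -> K^o) (z l M r : K) :
  0 < r -> 0 < M ->
  (forall h, `|h| <= r -> `|f (z + h) - f z - h * l| <= M * `|h| ^+ 2) ->
  f^`()%classic z = l.
Proof.
move=> r0 M0 key.
apply: (@cvg_lim K^o (@norm_hausdorff _ _)); apply/cvgrPdist_le => /= e e0.
have r2 : 0 < e / M by rewrite divr_gt0.
near=> h.
have [|hn0 hr] := near (near_dnbhs_norm 0 r0) h => //.
have [|_ he] := near (near_dnbhs_norm 0 r2) h => //.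
rewrite subr0 in hr he.
have -> : l - h^-1 *: (f (h + z) - f z) = - (h^-1 * (f (z + h) - f z - h * l)).
  by rewrite (addrC h) [h^-1 *: _]/(h^-1 * _) mulrBr mulKf // opprB.
rewrite normrN normrM normfV ler_pdivrMl ?normr_gt0 //.
apply: le_trans (key h (ltW hr)) _; rewrite expr2 mulrCA ler_wpM2l //.
by rewrite mulrC -ler_pdivlMr // ltW.
Unshelve. all: by end_near. Qed.

(** * The quotient Gamma(z + h) / Gamma(z) as a product *)

Section GammaFunction.
Variable R : realType.
Local Notation C := (R[i] : numFieldType).
Implicit Types (z h : R[i]).

Definition gamma_pole_free z := forall k : nat, z + k%:R != 0.

Definition gamma_seq n z : R[i] :=
  n`!%:R * nat_cpow n z / \prod_(0 <= k < n.+1) (z + k%:R).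

(** n^h is spread over the factors by means of [ln_step], so that the first-order parts h ln_step(k)
    and h/(z + k) nearly cancel and each factor is 1 + O(k^-2). *)
Definition gamma_factor z h k : R[i] :=
  cexp (h * (ln_step R k)%:C) / (1 + h / (z + k%:R)).

Lemma cexp_sum (I : Type) (s : seq I) (F : I -> R[i]) :
  cexp (\sum_(i <- s) F i) = \prod_(i <- s) cexp (F i).
Proof.
elim: s => [|i s IH]; first by rewrite !big_nil cexp0.
by rewrite !big_cons cexpD IH.
Qed.

Lemma gamma_seqD n z h : gamma_pole_free z -> gamma_pole_free (z + h) ->
  gamma_seq n (z + h) = gamma_seq n z * \prod_(k < n.+1) gamma_factor z h k.
Proof.
move=> z0 zh0; rewrite /gamma_seq /nat_cpow mulrDl cexpD.
have -> : cexp (h * (ln n%:R)%:C) =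
    \prod_(k < n.+1) cexp (h * (ln_step R k)%:C).
  by rewrite -sum_ln_step rmorph_sum mulr_sumr cexp_sum.
rewrite /gamma_factor prodf_div !big_mkord.
have -> : \prod_(k < n.+1) (1 + h / (z + k%:R)) =
    (\prod_(k < n.+1) (z + h + k%:R)) / \prod_(k < n.+1) (z + k%:R).
  rewrite -prodf_div; apply: eq_bigr => k _.
  by rewrite (addrAC z) (mulrDl _ h) divff.
have A0 : \prod_(k < n.+1) (z + k%:R) != 0 by apply/prodf_neq0 => k _.
have B0 : \prod_(k < n.+1) (z + h + k%:R) != 0 by apply/prodf_neq0 => k _.
move: (\prod_(k < n.+1) (z + k%:R)) A0 (\prod_(k < n.+1) (z + h + k%:R)) B0.
move: (\prod_(k < n.+1) _) => c a a0 b b0; field; by rewrite a0 b0.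
Qed.

Lemma gamma_step_bounds z : gamma_pole_free z -> exists2 A : R[i], 0 < A &
  forall k, [/\ `|(z + k%:R)^-1| <= A * k.+1%:R^-1,
    `|(ln_step R k)%:C| <= A * k.+1%:R^-1 &
    `|(ln_step R k)%:C - (z + k%:R)^-1| <= A * k.+1%:R ^- 2].
Proof.
(* The point 1 - z is chosen because (k + 1) - (1 - z) = z + k. *)
move=> z0; have [A A0 HA] := ratio_bounded (@harmonic0C R) (1 - z).
have e k : k.+1%:R - (1 - z) = z + k%:R :> R[i] by rewrite -natr1; ring.
have k0 k : k.+1%:R != 0 :> R[i] by rewrite pnatr_eq0.
have H1 k : `|(z + k%:R)^-1| <= A * k.+1%:R^-1.
  have := HA k; rewrite e normrM normr_nat mulrC => h.
  by rewrite ler_pdivlMr.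
have lC k : `|(ln_step R k)%:C - k.+1%:R^-1| <= 6 * k.+1%:R ^- 2.
  have -> : 6 * k.+1%:R ^- 2 = (6 * k.+1%:R ^- 2 : R)%:C.
    by rewrite rmorphM rmorph_nat fmorphV rmorphXn rmorph_nat.
  have -> : k.+1%:R^-1 = (k.+1%:R^-1 : R)%:C by rewrite fmorphV rmorph_nat.
  by rewrite -rmorphB normCR lecR ln_step_bound.
have J1 k : k.+1%:R ^- 2 <= k.+1%:R^-1 :> R[i].
  by rewrite lef_pV2 ?posrE ?exprn_gt0 // expr2 ler_peMl // ler1n.
have z1 : 0 <= `|z - 1| * A by rewrite mulr_ge0 // ltW.
(* [A] serves the inverse, 7 = 6 + 1 the logarithmic step, and [|z - 1| * A] the difference between
   1/(k + 1) and 1/(z + k). *)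
exists (A + 7 + `|z - 1| * A) => [|k]; first by rewrite ltr_wpDr // addr_gt0.
split.
- apply: le_trans (H1 k) _; rewrite ler_wpM2r ?invr_ge0 // -addrA lerDl addr_ge0 //.
- apply: (@le_trans _ _ (7 * k.+1%:R^-1)); last first.
    by rewrite ler_wpM2r ?invr_ge0 // addrAC lerDr addr_ge0 // ltW.
  rewrite -[(_)%:C](subrK k.+1%:R^-1); apply: le_trans (ler_normD _ _) _.
  have -> : 7 * k.+1%:R^-1 = 6 * k.+1%:R^-1 + k.+1%:R^-1 :> R[i] by ring.
  rewrite [`|_^-1|]ger0_norm ?invr_ge0 // lerD2r.
  by apply: le_trans (lC k) _; rewrite ler_wpM2l.
have -> : (ln_step R k)%:C - (z + k%:R)^-1 = ((ln_step R k)%:C - k.+1%:R^-1) +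
    (z - 1) * k.+1%:R^-1 * (z + k%:R)^-1.
  have := z0 k; have := k0 k; rewrite -natr1 => a b.
  by field; rewrite a b.
apply: le_trans (ler_normD _ _) _.
apply: (@le_trans _ _ (6 * k.+1%:R ^- 2 + `|z - 1| * A * k.+1%:R ^- 2)).
  apply: lerD => //; rewrite 2!normrM normfV normr_nat -!mulrA ler_wpM2l //.
  by rewrite -exprVn expr2 mulrCA ler_wpM2l ?invr_ge0.
rewrite -mulrDl ler_wpM2r ?invr_ge0 ?exprn_ge0 // lerD2r.
by rewrite -[leLHS]add0r; apply: lerD; [exact: ltW|rewrite ler_nat].
Qed.

(** With eps the second-order remainder of the exponential, the factor minus 1 is (h (l - y) + eps)
    / (1 + h y), and the inverse of 1 + h y is at most 2 in modulus. The constant 18 is 2 (8 + 1): 8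
    from eps, 1 from h y times h (l - y). *)
Lemma gamma_factor_bounds z h A k (l := (ln_step R k)%:C) (y := (z + k%:R)^-1) :
  0 <= A -> `|y| <= A * k.+1%:R^-1 -> `|l| <= A * k.+1%:R^-1 ->
  `|l - y| <= A * k.+1%:R ^- 2 -> `|h| * A * k.+1%:R^-1 <= 2^-1 ->
  [/\ 1 + h * y != 0,
   `|gamma_factor z h k - 1| <= 2 * (`|h| * A + 8 * (`|h| * A) ^+ 2) * k.+1%:R ^- 2 &
   `|gamma_factor z h k - 1 - h * (l - y)| <=
     18 * A ^+ 2 * `|h| ^+ 2 * k.+1%:R ^- 2].
Proof.
move=> A0 yA lA lyA hA; set J := k.+1%:R^-1 in yA lA hA.
have J0 : 0 <= J by rewrite invr_ge0.
have J2 : k.+1%:R ^- 2 = J ^+ 2 by rewrite -exprVn.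
rewrite J2 in lyA *.
have hl : `|h * l| <= `|h| * A * J by rewrite normrM -mulrA ler_wpM2l.
have hy : `|h * y| <= `|h| * A * J by rewrite normrM -mulrA ler_wpM2l.
have [hy1 hy2] : h * y != -1 /\ `|(1 + h * y)^-1| <= 2.
  have [|a b] := @geom_half C (- (h * y)); first by rewrite normrN (le_trans hy).
  by rewrite opprK in b; rewrite -eqr_oppLR.
have D0 : 1 + h * y != 0 by rewrite addrC -[1]opprK subr_eq0.
have He := cexp_sub_le (le_trans hl hA).
set eps := cexp (h * l) - 1 - h * l in He.
have {}He : `|eps| <= 8 * (`|h| * A) ^+ 2 * J ^+ 2.
  apply: le_trans He _; rewrite -mulrA -exprMn ler_wpM2l //.
  by rewrite lerXn2r ?nnegrE ?mulr_ge0.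
have xE : gamma_factor z h k - 1 = (h * (l - y) + eps) / (1 + h * y).
  rewrite /gamma_factor -/l -/y; apply: (mulIf D0).
  by rewrite mulrBl !divfK // /eps; ring.
have x2E : gamma_factor z h k - 1 - h * (l - y) =
    (eps - h * y * (h * (l - y))) / (1 + h * y).
  by apply: (mulIf D0); rewrite xE mulrBl !divfK //; ring.
split=> //.
  rewrite xE normrM mulrC -[leRHS]mulrA; apply: ler_pM => //.
  apply: le_trans (ler_normD _ _) _; rewrite mulrDl; apply: lerD => //.
  by rewrite normrM -mulrA ler_wpM2l.
rewrite x2E normrM mulrC.
have -> : 18 * A ^+ 2 * `|h| ^+ 2 * J ^+ 2 =
    2 * (8 * (`|h| * A) ^+ 2 * J ^+ 2 + (`|h| * A) ^+ 2 * J ^+ 2) by ring.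
apply: ler_pM => //; apply: le_trans (ler_normB _ _) _; apply: lerD => //.
rewrite normrM [`|h * (l - y)|]normrM.
have -> : (`|h| * A) ^+ 2 * J ^+ 2 = (`|h| * A) * (`|h| * (A * J ^+ 2)) by ring.
apply: ler_pM => //; last by rewrite ler_wpM2l.
by apply: le_trans hy _; rewrite ler_piMr ?mulr_ge0 // /J invf_le1 // ler1n.
Qed.

End GammaFunction.

Section Digamma.
Variable R : realType.
Local Notation C := (R[i] : numFieldType).
Implicit Types (z h : R[i]).

Lemma cvg_shift1 (u : nat -> C) (l : C) : u n @[n --> \oo] --> l ->
  u n.+1 @[n --> \oo] --> l.
Proof.
move=> ul; have := ul; rewrite -(cvg_shiftn 1) /=.
by under eq_fun do rewrite addn1.
Qed.

Lemma gamma_seq1_cvg : (gamma_seq n (1 : R[i]) : C) @[n --> \oo] --> (1 : C).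
Proof.
(* Index 0 is skipped: [nat_cpow 0 1] is 1, as [ln 0 = 0]. From index 1 on the term is n/(n + 1). *)
rewrite -(cvg_shiftn 1) /=.
have H : 1 - (n.+1%:R^-1 : C) @[n --> \oo] --> (1 - 0 : C).
  by apply: cvgB; [exact: cvg_cst|exact: harmonic0C].
have := cvg_shift1 H; rewrite subr0 => {}H; apply: cvg_trans H.
apply: near_eq_cvg; apply: nearW => n /=.
rewrite addn1 /gamma_seq /nat_cpow mul1r cexp_real lnK ?posrE //.
have -> : \prod_(0 <= k < n.+2) (1 + k%:R) = n.+2`!%:R :> R[i].
  elim: n.+2 => [|m IH]; first by rewrite big_geq.
  by rewrite big_nat_recr //= IH factS natrM mulrC nat1r.
rewrite (factS n.+1) natrM -natCR.
have f0 : n.+1`!%:R != 0 :> R[i] by rewrite pnatr_eq0 -lt0n fact_gt0.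
have n0 : n.+2%:R != 0 :> R[i] by rewrite pnatr_eq0.
transitivity (n.+1%:R / n.+2%:R : R[i]).
  by rewrite -[n.+1%:R](addrK 1) natr1 mulrBl divff // mul1r.
by move: (n.+1`!%:R : R[i]) (n.+2%:R : R[i]) (n.+1%:R : R[i]) f0 n0 => a b c a0 b0;
  field; rewrite a0 b0.
Qed.

Lemma gamma_pole_free1 : gamma_pole_free (1 : R[i]).
Proof. by move=> k; rewrite nat1r pnatr_eq0. Qed.

Lemma gamma_seq_neq0 z n : gamma_pole_free z -> gamma_seq n z != 0.
Proof.
move=> z0; rewrite /gamma_seq big_mkord mulf_neq0 ?invr_eq0 //; last first.
  by apply/prodf_neq0 => k _.
by rewrite mulf_neq0 ?cexp_neq0 // pnatr_eq0 -lt0n fact_gt0.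
Qed.

(** Comparison with the point 1, where the limit is known. The increment z - 1 need not be small, so
    the factor bounds hold only from some index on. *)
Lemma gamma_seq_cvg z : gamma_pole_free z ->
  exists2 l : C, l != 0 & (gamma_seq n z : C) @[n --> \oo] --> l.
Proof.
move=> z0; pose h := z - 1; have zE : z = 1 + h by rewrite addrC subrK.
have [A A0 HA] := gamma_step_bounds gamma_pole_free1.
have [N HN] : exists N, forall n, `|h| * A * (n + N).+1%:R^-1 <= 2^-1.
  have e0 : 0 < 2^-1 :> C by rewrite invr_gt0.
  have H : (`|h| * A * n.+1%:R^-1 : C) @[n --> \oo] --> (`|h| * A * 0 : C).
    by apply: cvgM; [exact: cvg_cst|exact: harmonic0C].
  have /cvgrPdist_lt/(_ _ e0)[N _ HN] := H; exists N => n.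
  have /= := HN (n + N)%N (leq_addl _ _); rewrite mulr0 sub0r normrN => /ltW.
  by rewrite ger0_norm // mulr_ge0 ?invr_ge0 // mulr_ge0 // ltW.
have Hx n : `|gamma_factor 1 h (n + N) - 1| <=
    2 * (`|h| * A + 8 * (`|h| * A) ^+ 2) * n.+1%:R ^- 2.
  have [h1 h2 h3] := HA (n + N)%N.
  have [_ H _] := gamma_factor_bounds (ltW A0) h1 h2 h3 (HN n).
  apply: le_trans H _; rewrite ler_wpM2l //.
    have hA0 : 0 <= `|h| * A by rewrite mulr_ge0 // ltW.
    by rewrite mulr_ge0 // addr_ge0 // mulr_ge0 // exprn_ge0.
  rewrite lef_pV2 ?posrE ?exprn_gt0 // lerXn2r ?nnegrE // ler_nat ltnS.
  exact: leq_addr.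
have Hx0 n : 1 + (gamma_factor 1 h n - 1) != 0.
  rewrite addrC subrK /gamma_factor mulf_neq0 ?cexp_neq0 // invr_eq0.
  have k0 := gamma_pole_free1 n.
  rewrite -{1}(divff k0) -mulrDl mulf_neq0 ?invr_eq0 // addrAC -zE.
  exact: z0.
have [l l0 Hl] := prod_cvg (@harmonic0C R) (@inv_sq_completeC R) Hx Hx0.
exists (1 * l); first by rewrite mul1r.
have -> : (fun n => gamma_seq n z : C) = (fun n => gamma_seq n 1 *
    \prod_(k < n.+1) (1 + (gamma_factor 1 h k - 1)) : C).
  apply/funext => n; rewrite {1}zE gamma_seqD; last 2 first.
  - exact: gamma_pole_free1.
  - by rewrite -zE.
  by congr (_ * _); apply: eq_bigr => k _; rewrite addrC subrK.
by apply: cvgM; [exact: gamma_seq1_cvg|exact: cvg_shift1 Hl].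
Qed.

Lemma GammaP z : gamma_pole_free z -> (Gamma z : R[i]) != 0 /\
  (gamma_seq n z : C) @[n --> \oo] --> (Gamma z : C).
Proof.
move=> z0; have [l l0 Hl] := gamma_seq_cvg z0.
have -> // : Gamma z = l.
by apply: (@cvg_lim R[i]^o (@norm_hausdorff _ _)); exact: Hl.
Qed.

(** Uniformity in [n] is the point: [Gamma_derive] lets [n] grow in this bound, and so
    differentiates [Gamma] without differentiating any [gamma_seq]. *)
Lemma gamma_seq_expand z (t := fun k => (ln_step R k)%:C - (z + k%:R)^-1) :
  gamma_pole_free z -> exists M r : R[i], [/\ 0 < M, 0 < r &
  forall h, `|h| <= r -> gamma_pole_free (z + h) /\
    forall n, `|gamma_seq n (z + h) / gamma_seq n z - 1 -
                h * \sum_(k < n.+1) t k| <= M * `|h| ^+ 2].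
Proof.
move=> z0; have [A A0 HA] := gamma_step_bounds z0.
have A1 := ltW A0.
(* As [|h| <= 1], the distance of the k-th factor to 1 is at most [|h| * B * k.+1%:R ^- 2]. *)
pose B := 2 * (A + 8 * A ^+ 2).
have B0 : 0 < B by rewrite mulr_gt0 // addr_gt0 // mulr_gt0 // exprn_gt0.
(* 36 is 18 times 2, a bound on the sum of inverse squares; 8 B^2 is the 2 (2 B)^2 of
   [prod_sub_le]. *)
pose M := 36 * A ^+ 2 + 8 * B ^+ 2.
have M0 : 0 < M by rewrite addr_gt0 // mulr_gt0 // exprn_gt0.
(* This radius enforces [|h| <= 1], [|h| * A <= 2^-1] and [|h| * B <= 4^-1] at once. *)
pose r := (1 + 2 * A + 4 * B)^-1.
have r'0 : 0 < 1 + 2 * A + 4 * B by rewrite !addr_gt0 // mulr_gt0.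
have r0 : 0 < r by rewrite invr_gt0.
exists M, r; split=> // h hr.
have hr' : `|h| * (1 + 2 * A + 4 * B) <= 1 by rewrite -ler_pdivlMr // div1r.
have hD : `|h| * (1 + 2 * A + 4 * B) = `|h| + (2 * (`|h| * A) + 4 * (`|h| * B)).
  by ring.
have hA0 : 0 <= `|h| * A by rewrite mulr_ge0.
have hB0 : 0 <= `|h| * B by rewrite mulr_ge0 // ltW.
rewrite hD in hr'.
have h1 : `|h| <= 1.
  by apply: le_trans hr'; rewrite lerDl addr_ge0 // mulr_ge0.
have h2 : `|h| * A <= 2^-1.
  rewrite -[2^-1]mulr1 ler_pdivlMl //; apply: le_trans hr'.
  by rewrite addrCA lerDl addr_ge0 // mulr_ge0.
have h3 : `|h| * B <= 4^-1.
  rewrite -[4^-1]mulr1 ler_pdivlMl //; apply: le_trans hr'.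
  by rewrite addrA lerDr addr_ge0 // mulr_ge0.
have HF k : [/\ 1 + h * (z + k%:R)^-1 != 0,
    `|gamma_factor z h k - 1| <= `|h| * B * k.+1%:R ^- 2 &
    `|gamma_factor z h k - 1 - h * t k| <= 18 * A ^+ 2 * `|h| ^+ 2 * k.+1%:R ^- 2].
  have [a1 a2 a3] := HA k.
  have [|b1 b2 b3] := gamma_factor_bounds (h := h) (ltW A0) a1 a2 a3.
    apply: le_trans h2; rewrite ler_piMr ?invf_le1 ?ler1n // mulr_ge0 // ltW //.
  split=> //; apply: le_trans b2 _; rewrite ler_wpM2r ?invr_ge0 ?exprn_ge0 //.
  have -> : `|h| * B = 2 * (`|h| * A + 8 * (`|h| * A ^+ 2)) by rewrite /B; ring.
  rewrite ler_wpM2l // lerD2l ler_wpM2l // exprMn ler_wpM2r ?exprn_ge0 //.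
  by rewrite expr2 -[leRHS]mul1r ler_wpM2r.
have zh0 : gamma_pole_free (z + h).
  move=> k; have [b1 _ _] := HF k; have := mulf_neq0 b1 (z0 k).
  by rewrite mulrDl mul1r divfK ?z0 // addrAC.
pose x k := gamma_factor z h k - 1.
have xE k : 1 + x k = gamma_factor z h k by rewrite addrC subrK.
split=> // n.
have -> : gamma_seq n (z + h) / gamma_seq n z = \prod_(k < n.+1) gamma_factor z h k.
  by rewrite gamma_seqD // mulrAC divff ?mul1r // gamma_seq_neq0.
have S1 : \sum_(k < n.+1) `|x k| <= 2 * (`|h| * B).
  apply: (@le_trans _ _ (\sum_(k < n.+1) `|h| * B * k.+1%:R ^- 2)).
    by apply: ler_sum => k _; have [] := HF k.
  by rewrite -mulr_sumr mulrC ler_wpM2r // sum_inv_sq_le2.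
have [|_ P2] := @prod_sub_le C x n.+1.
  apply: le_trans S1 _; have -> : 2^-1 = 2 * 4^-1 :> C by field.
  by rewrite ler_wpM2l.
under [X in `|X - 1 - _|]eq_bigr do rewrite -xE.
have -> : \prod_(k < n.+1) (1 + x k) - 1 - h * \sum_(k < n.+1) t k =
    (\prod_(k < n.+1) (1 + x k) - 1 - \sum_(k < n.+1) x k) +
    \sum_(k < n.+1) (x k - h * t k).
  by rewrite [X in _ = _ + X]sumrB -mulr_sumr; ring.
apply: le_trans (ler_normD _ _) _; rewrite /M mulrDl addrC; apply: lerD.
  apply: le_trans (ler_norm_sum _ _ _) _.
  apply: (@le_trans _ _ (\sum_(k < n.+1) 18 * A ^+ 2 * `|h| ^+ 2 * k.+1%:R ^- 2)).
    by apply: ler_sum => k _; have [] := HF k.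
  rewrite -mulr_sumr; have -> : 36 * A ^+ 2 * `|h| ^+ 2 =
    18 * A ^+ 2 * `|h| ^+ 2 * 2 by ring.
  by rewrite ler_wpM2l ?sum_inv_sq_le2 // !mulr_ge0 ?exprn_ge0.
apply: le_trans P2 _; have -> : 8 * B ^+ 2 * `|h| ^+ 2 =
  2 * (2 * (`|h| * B)) ^+ 2 by ring.
have S2 : 0 <= 2 * (`|h| * B) by rewrite mulr_ge0.
by rewrite ler_wpM2l // lerXn2r ?nnegrE //; apply: sumr_ge0.
Qed.

Lemma Gamma_derive z : gamma_pole_free z -> exists2 d : C,
  ((ln n%:R)%:C - \sum_(k < n.+1) (z + k%:R)^-1 : C) @[n --> \oo] --> d &
  (@Gamma R)^`()%classic z = d * Gamma z.
Proof.
move=> z0; have [A A0 HA] := gamma_step_bounds z0.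
pose t k : C := (ln_step R k)%:C - (z + k%:R)^-1.
have [d Hd] : exists d : C, \sum_(k < n) t k @[n --> \oo] --> d.
  by apply: (@inv_sq_completeC R t A) => k; have [] := HA k.
have {}Hd := cvg_shift1 Hd.
exists d.
  have -> // : (fun n => (ln n%:R)%:C - \sum_(k < n.+1) (z + k%:R)^-1 : C) =
    (fun n => \sum_(k < n.+1) t k).
  by apply/funext => n; rewrite sumrB -sum_ln_step rmorph_sum.
have [G0 HG] := GammaP z0.
have [M [r [M0 r0 HM]]] := gamma_seq_expand z0.
apply: (@derive1_quadratic C (@Gamma R) z _ (`|Gamma z : R[i]| * M) r r0).
  by rewrite mulr_gt0 // normr_gt0.
move=> h /HM[zh0 HB]; have [_ HGh] := GammaP zh0.
rewrite -mulrA mulrA.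
exact: (limit_ratio_bound G0 HG HGh Hd HB).
Qed.

Lemma digamma_cvg z : gamma_pole_free z ->
  ((ln n%:R)%:C - \sum_(k < n.+1) (z + k%:R)^-1 : C) @[n --> \oo] -->
  (digamma z : C).
Proof.
move=> z0; have [d Hd Gd] := Gamma_derive z0; have [G0 _] := GammaP z0.
by rewrite /digamma Gd mulfK.
Qed.

Lemma euler_gamma_cvg :
  (harmonic_number R n - ln n%:R) @[n --> \oo] --> euler_gamma R.
Proof.
have /cvg_ex[l Hl] : cvgn (series (fun k => ln_step R k - k.+1%:R^-1)).
  exact: inv_sq_series_cvg (@ln_step_bound R).
suff /cvgP : (harmonic_number R n - ln n%:R) @[n --> \oo] --> - l - 0 by [].
(* The first n + 1 terms collect ln n and H_(n+1); subtracting 1/(n + 1) restores H_n. *)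
have H : - series (fun k => ln_step R k - k.+1%:R^-1) (n + 1)%N - harmonic n
    @[n --> \oo] --> - l - 0.
  apply: cvgB; last exact: cvg_harmonic.
  by apply: cvgN; move: Hl; rewrite -(cvg_shiftn 1).
apply: cvg_trans H; apply: near_eq_cvg; apply: nearW => n.
rewrite addn1 [in LHS]/series /= big_mkord sumrB sum_ln_step.
by rewrite sum_inv_harmonic harmonic_numberS; ring.
Qed.

Lemma digamma_sum_cvg (s : R[i]) : (forall n, n%:R != s) ->
  (digamma_sum N s : C) @[N --> \oo] --> (digamma (- s) + (euler_gamma R)%:C : C).
Proof.
move=> sn; have s0 : gamma_pole_free (- s) by move=> k; rewrite addrC subr_eq0.
have H : ((ln N%:R)%:C - \sum_(k < N.+1) (- s + k%:R)^-1 +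
    (harmonic_number R N - ln N%:R)%:C : C) @[N --> \oo] -->
    (digamma (- s) + (euler_gamma R)%:C : C).
  by apply: cvgD; [exact: digamma_cvg|apply: cvg_realC; exact: euler_gamma_cvg].
apply: cvg_trans H; apply: near_eq_cvg; apply: nearW => N.
have -> : (harmonic_number R N - ln N%:R)%:C =
    harmonic_number R[i] N - (ln N%:R)%:C by rewrite harmonic_numberC rmorphB.
rewrite /digamma_sum /psi_term sumrB sum_inv_harmonic.
have -> : \sum_(k < N.+1) (- s + k%:R)^-1 =
    - s^-1 + \sum_(k < N) (k.+1%:R - s)^-1.
  rewrite big_ord_recl addr0 invrN; congr (_ + _).
  by apply: eq_bigr => k _; rewrite addrC.
by ring.
Qed.

End Digamma.

(** * Laurent series *)

Section LaurentSeries.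
Variable K : numFieldType.
Implicit Types (f g : K -> K) (a b z r : K) (c d : nat -> K).

(** The remainder of order 2 is the quadratic bound that gives a derivative; [c 0 = f a] supplies
    the value at [a], which [taylor] ignores. *)
Lemma taylor_derive (f : K -> K^o) a c : taylor f a c -> c 0%N = f a ->
  f^`()%classic a = c 1%N.
Proof.
move=> [C [rho [C0 rho0 H]]] c0; have [e e0 He] := dnbhs_normP H.
have e20 : 0 < e / 2 by rewrite divr_gt0.
have M0 : 0 < C * rho ^+ 2 + 1 by rewrite ltr_wpDl // mulr_ge0 // exprn_ge0.
apply: (derive1_quadratic e20 M0) => h he.
have [->|h0] := eqVneq h 0.
  by rewrite addr0 mul0r subrr subr0 normr0 mulr_ge0 // ltW.
have := He (a + h); rewrite [a + h - a]addrC addKr -subr_eq0 [a + h - a]addrC addKr.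
move=> /(_ h0) /(_ _)/(_ 2%N) Hh; apply: (@le_trans _ _ (C * (rho * `|h|) ^+ 2)).
  apply: le_trans (Hh _); last first.
    by apply: le_lt_trans he _; rewrite ltr_pdivrMr // ltr_pMr // ltr1n.
  by rewrite !big_ord_recl big_ord0 c0 expr0 expr1 mulr1 addr0 opprD addrA (mulrC h).
by rewrite exprMn mulrA mulrDl mul1r lerDl exprn_ge0.
Qed.

Lemma eval_terms_derive (L : seq (K * K * nat)) (s : seq K) (f : K -> K^o) z :
  all (fun t => t.1.2 \in s) L -> (forall y, y \notin s -> f y = eval_terms L y) ->
  z \notin s -> f^`()%classic z =
    \sum_(t <- L) t.1.1 * (- t.2.+1%:R * (z - t.1.2) ^- t.2.+2).
Proof.
move=> sL fE zs.
have [c [Hc c0 c1]] : exists c, [/\ taylor (eval_terms L) z c,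
    c 0%N = eval_terms L z &
    c 1%N = \sum_(t <- L) t.1.1 * (- t.2.+1%:R * (z - t.1.2) ^- t.2.+2)].
  elim: L sL {fE} => [_|t L IH /= /andP[ts /IH[c [Hc c0 c1]]]].
    exists (fun k => 0 *+ (k == 0%N)); rewrite /eval_terms !big_nil mul0rn; split=> //.
    by apply: taylor_eq (taylor_cst 0 z); apply: nearW => y; rewrite big_nil.
  have tz : t.1.2 != z by apply: contraNneq zs => <-.
  have [d [[Hd _] d0 d1]] := euler_taylor_invX t.2.+1 tz.
  exists (fun k => t.1.1 * d k + c k); split.
  - apply: taylor_eq (taylorD (taylorZ t.1.1 Hd) Hc).
    by apply: nearW => y; rewrite /eval_terms big_cons.
  - by rewrite c0 d0 /eval_terms big_cons.
  - by rewrite c1 d1 big_cons.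
rewrite -c1; apply: taylor_derive; last by rewrite c0 fE.
apply: taylor_eq Hc; near=> y; rewrite fE //.
by apply: (near (near_notin s z) y).
Unshelve. all: by end_near. Qed.

(** Abel's argument: convergence at the single point a + r/2 bounds the terms there by 2 M, so at
    half that distance the tails are dominated by a geometric series of ratio at most 1/2. *)
Lemma taylor_of_series g a d r : 0 < r ->
  (forall z, z != a -> `|z - a| < r ->
     \sum_(k < N) d k * (z - a) ^+ k @[N --> \oo] --> g z) -> taylor g a d.
Proof.
move=> r0 H; have r2 : 0 < r / 2 by rewrite divr_gt0.
pose x0 := r / 2; have x0r : `|x0| < r.
  by rewrite ger0_norm ?(ltW r2) // ltr_pdivrMr // ltr_pMr // ltr1n.
have x00 : 0 < `|x0| by rewrite normr_gt0 gt_eqF.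
have ax : a + x0 - a = x0 by rewrite addrC addKr.
have Hx : \sum_(k < N) d k * x0 ^+ k @[N --> \oo] --> g (a + x0).
  have := H (a + x0); rewrite ax; apply=> //.
  by rewrite -subr_eq0 ax gt_eqF.
have [M HM] := cvg_norm_bounded Hx.
have M0 : 0 <= M := le_trans (normr_ge0 _) (HM 0%N).
have dM k : `|d k| * `|x0| ^+ k <= 2 * M.
  have -> : `|d k| * `|x0| ^+ k =
      `|\sum_(i < k.+1) d i * x0 ^+ i - \sum_(i < k) d i * x0 ^+ i|.
    by rewrite big_ord_recr /= addrAC subrr add0r [RHS]normrM normrX.
  by apply: le_trans (ler_normB _ _) _; rewrite mulr_natl mulr2n; apply: lerD.
exists (4 * M), `|x0|^-1; split; rewrite ?mulr_ge0 ?invr_ge0 //.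
have x02 : 0 < `|x0| / 2 by rewrite divr_gt0.
near=> z => N.
have [|za zr] := near (near_dnbhs_norm a r0) z => //.
have [|_ zx] := near (near_dnbhs_norm a x02) z => //.
have := H z za zr.
set x := z - a in zr zx * => Hz; pose q := `|x0|^-1 * `|x|.
have q0 : 0 <= q by rewrite mulr_ge0 // invr_ge0.
have qh : q <= 2^-1 by rewrite /q ler_pdivrMl // ltW.
have Hq n : \sum_(k < n) q ^+ k <= 2.
  have [|q1 q2] := @geom_half K q; first by rewrite ger0_norm.
  have <- : (1 - q)^-1 - q ^+ n / (1 - q) = \sum_(k < n) q ^+ k.
    by rewrite -(geom_rem1 n q1) subKr.
  have qq : 0 <= (1 - q)^-1.
    by rewrite invr_ge0 subr_ge0 (le_trans qh) // invf_le1 // ler1n.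
  rewrite ger0_norm // in q2; apply: le_trans q2.
  by rewrite lerBlDr lerDl mulr_ge0 // exprn_ge0.
have Hd k : `|d k * x ^+ k| <= 2 * M * q ^+ k.
  rewrite normrM normrX /q exprMn exprVn mulrA ler_wpM2r ?exprn_ge0 //.
  by rewrite ler_pdivlMr ?exprn_gt0.
have Hlim : \sum_(k < n + N) d k * x ^+ k - \sum_(k < N) d k * x ^+ k
    @[n --> \oo] --> g z - \sum_(k < N) d k * x ^+ k.
  apply: cvgB; last exact: cvg_cst.
  by move: Hz; rewrite -(cvg_shiftn N).
apply: (cvg_norm_le Hlim) => n.
rewrite addnC big_split_ord /= addrAC subrr add0r.
apply: le_trans (ler_norm_sum _ _ _) _.
apply: (@le_trans _ _ (\sum_(k < n) 2 * M * q ^+ N * q ^+ k)).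
  by apply: ler_sum => k _; apply: le_trans (Hd _) _; rewrite exprD mulrA.
rewrite -mulr_sumr; have -> : 4 * M * q ^+ N = 2 * M * q ^+ N * 2 by ring.
by rewrite ler_wpM2l // !mulr_ge0 // exprn_ge0.
Unshelve. all: by end_near. Qed.

Hypothesis harmonic0 : (n.+1%:R^-1 : K) @[n --> \oo] --> (0 : K).

Lemma series_of_taylor g a d : taylor g a d -> exists2 r, 0 < r &
  forall z, z != a -> `|z - a| < r ->
     \sum_(k < N) d k * (z - a) ^+ k @[N --> \oo] --> g z.
Proof.
move=> [C [rho [C0 rho0 H]]].
have rho1 : 0 < 2 * rho + 1 by rewrite ltr_wpDl // mulr_ge0.
have e0 : 0 < (2 * rho + 1)^-1 by rewrite invr_gt0.
have /dnbhs_normP[r r0 Hr] : \forall z \near a^', (forall N,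
    `|g z - \sum_(k < N) d k * (z - a) ^+ k| <= C * (rho * `|z - a|) ^+ N) /\
    `|z - a| < (2 * rho + 1)^-1.
  near=> z; split; first by apply: (near H z).
  by have [] := near (near_dnbhs_norm a e0) z.
exists r => // z za zr; have [Hz /ltW ze] := Hr z za zr.
have qh : rho * `|z - a| <= 2^-1.
  rewrite -[2^-1]mulr1 ler_pdivlMl // mulrA.
  move: ze; rewrite -[_^-1]mulr1 ler_pdivlMl // mulrDl mul1r; apply: le_trans.
  by rewrite lerDl.
apply/cvgrPdist_le => e ee.
(* The error is at most C / 2^n, and 2^n >= n + 1 compares it with the sequence 1/(n + 1). *)
have HC : C * n.+1%:R^-1 @[n --> \oo] --> C * 0.
  by apply: cvgM => //; exact: cvg_cst.
have /cvgrPdist_le/(_ e ee) := HC; apply: filterS => n.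
rewrite mulr0 sub0r normrN ger0_norm ?mulr_ge0 ?invr_ge0 //; apply: le_trans.
apply: le_trans (Hz n) _; rewrite ler_wpM2l //.
apply: (@le_trans _ _ (2^-1 ^+ n)).
  by rewrite lerXn2r ?nnegrE ?mulr_ge0 ?invr_ge0.
by rewrite exprVn lef_pV2 ?posrE ?exprn_gt0 // -natrX ler_nat ltn_expl.
Unshelve. all: by end_near. Qed.

End LaurentSeries.

Section Residue.
Variable R : realType.
Local Notation C := (R[i] : numFieldType).
Implicit Types (f : R[i] -> R[i]) (a z w : R[i]).

Lemma laurent_res_is f a (c : int -> R[i]) : laurent f a c ->
  @res_is C f a (c (- 1)).
Proof.
move=> [m [c0 [r r0 H]]]; pose d k := c (k%:Z - m%:Z).
have Hd : @taylor C (fun z => (z - a) ^+ m * f z) a d.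
  apply: (@taylor_of_series C _ a d r%:C); first by rewrite ltcR.
  move=> z za zr; have x0 : z - a != 0 by rewrite subr_eq0.
  have Hz : (\sum_(0 <= k < N) c (k%:Z - m%:Z) * (z - a) ^ (k%:Z - m%:Z) : C)
      @[N --> \oo] --> (f z : C) by apply: H => //; rewrite normr_gt0.
  have -> : (fun N => \sum_(k < N) d k * (z - a) ^+ k : C) = (fun N => (z - a) ^+ m *
      \sum_(0 <= k < N) c (k%:Z - m%:Z) * (z - a) ^ (k%:Z - m%:Z) : C).
    apply/funext => N; rewrite big_mkord mulr_sumr; apply: eq_bigr => k _.
    by rewrite mulrCA [(z - a) ^+ m]exprnP -expfzDr // (addrC m%:Z) subrK.
  by apply: cvgM; [exact: cvg_cst|exact: Hz].
exists m, (@shift_coef C d); split.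
  apply: taylor_eq (taylorX Hd); apply: nearW => z.
  by rewrite mulrA -exprS.
(* For [m = 0] the index -1 lies below [- m], so [c (- 1)] is 0, in agreement with the 0 inserted by
   [shift_coef]. *)
case: m c0 @d {H Hd} => [|m] c0 d /=; first by rewrite c0.
by rewrite /d; congr c; rewrite intS opprD addrA addrAC subrr add0r.
Qed.

Lemma res_is_laurent f a w : @res_is C f a w ->
  exists2 c : int -> R[i], laurent f a c & w = c (- 1).
Proof.
move=> [m [d [Hd dw]]].
pose c (n : int) := if n + m.+1%:Z is Posz k then d k else 0.
have [r /gt0C_real[r' r'0 ->] H] := series_of_taylor (@harmonic0C R) Hd.
exists c; last first.
  by rewrite /c intS addrA addNr add0r.
exists m.+1; split.
  by move=> n nm; rewrite /c; case E : (n + m.+1%:Z) => [k|//]; lia.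
exists r' => // z x0 zr; rewrite normr_gt0 in x0.
have za : z != a by rewrite -subr_eq0.
have Hz := H z za zr.
have -> : (fun N => \sum_(0 <= k < N) c (k%:Z - m.+1%:Z) * (z - a) ^ (k%:Z - m.+1%:Z) : C) =
    (fun N => (z - a) ^- m.+1 * \sum_(k < N) d k * (z - a) ^+ k : C).
  apply/funext => N; rewrite big_mkord mulr_sumr; apply: eq_bigr => k _.
  by rewrite mulrCA /c subrK expfzDr // (mulrC ((z - a) ^ k%:Z)).
have : ((z - a) ^- m.+1 * \sum_(k < N) d k * (z - a) ^+ k : C)
    @[N --> \oo] --> ((z - a) ^- m.+1 * ((z - a) ^+ m.+1 * f z) : C).
  by apply: cvgM; [exact: cvg_cst|exact: Hz].
by rewrite mulKf // expf_neq0.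
Qed.

Lemma residueE f a w : @res_is C f a w -> residue f a = w.
Proof.
move=> fw; apply: xget_unique.
  exact: res_is_laurent fw.
by move=> v [c /laurent_res_is fc ->]; exact: res_is_uniq fc fw.
Qed.

End Residue.

(** * The summation formula *)

Lemma archi_normC (R : realType) (B : R) : exists N : nat,
  forall n, B%:C <= `|((n + N).+1%:R : R[i])|.
Proof.
have [N HN] : exists N : nat, B <= N%:R.
  exists (Num.bound `|B|); apply: le_trans (ler_norm B) _.
  exact: ltW (archi_boundP (normr_ge0 B)).
exists N => n; rewrite normr_nat natCR lecR; apply: le_trans HN _.
by rewrite ler_nat leqW // leq_addl.
Qed.

Lemma residue_term (R : realType) (a : R[i]) (t : R[i] * R[i] * nat)
    (phi := fun s : R[i] => digamma (- s) + (euler_gamma R)%:C) :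
  (forall n, n.+1%:R != a) ->
  exists l : R[i], @res_is R[i] (fun z => - t.2.+1%:R * (z - t.1.2) ^- t.2.+2 * phi z
       - (z - t.1.2) ^- t.2.+1 * phi z ^+ 2) a l /\
    ((if a == t.1.2 then - square_coef a N t.2 else 0 : (R[i] : numFieldType))
       @[N --> \oo] --> (l : (R[i] : numFieldType))).
Proof.
move=> na; have [delta d0 Hd] := away_exists (@harmonic0C R) na.
have Hphi : \forall z \near (a : (R[i] : numFieldType))^',
    (digamma_sum N z : (R[i] : numFieldType)) @[N --> \oo] -->
    (phi z : (R[i] : numFieldType)).
  near=> z; apply: digamma_sum_cvg.
  exact: (near (near_not_nat d0 Hd) z).
have [l H1 H2] := residue_pole_part d0 Hd (@inv_sq_completeC R) t.1.2 t.2 Hphi.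
by exists l.
Unshelve. all: by end_near. Qed.

Theorem proposition1 (R : realType) (p q : {poly R[i]})
  (hq : q != 0)
  (hO : exists M B : R, forall z : R[i],
      B%:C <= `|z| -> `|ratfun p q z| <= M%:C * `|z ^ (- 2)|)
  (hpoles : forall n : int, poles p q n%:~R -> n = 0) :
  (\sum_(1 <= k < N) ratfun p q k%:R * harmonic_number R[i] k : R[i]^o)
      @[N --> \oo] -->
    (2^-1 * \sum_(a \in poles p q)
      residue (fun s : R[i] =>
        (ratfun p q)^`()%classic s * (digamma (- s) + (euler_gamma R)%:C)
        - ratfun p q s * (digamma (- s) + (euler_gamma R)%:C) ^+ 2) a : R[i]^o).
Proof.
pose phi (s : R[i]) := digamma (- s) + (euler_gamma R)%:C.
have den0 : ratfun_den p q != 0.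
  by rewrite dvdp_div_eq0 ?dvdp_gcdr.
have [s0 denE] := closed_field_poly_normal (ratfun_den p q).
(* [s0] repeats roots by multiplicity, as the factorization requires; the residue sum runs over the
   distinct poles. *)
pose s := undup s0.
have root_s z : root (ratfun_den p q) z = (z \in s).
  rewrite denE rootZ ?lead_coef_eq0 // root_prod_XsubC mem_undup //.
have polesE : poles p q = [set` s].
  by apply/seteqP; split => z; rewrite /poles /= root_s.
have ns n : n.+1%:R \notin s.
  apply/negP => ns.
  have /hpoles : poles p q (n.+1%:Z)%:~R by rewrite /poles /= root_s.
  by [].
(* The decay hypothesis speaks only of large arguments; the finitely many remaining integers are
   absorbed into the constant. *)
have [M fM] : exists M : R[i], forall n, `|ratfun p q n.+1%:R| <= M * n.+1%:R ^- 2.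
  have [M [B HM]] := hO; have [N HN] := archi_normC B.
  have nE n : `|ratfun p q n.+1%:R * n.+1%:R ^+ 2| =
      `|ratfun p q n.+1%:R| * n.+1%:R ^+ 2.
    by rewrite (normrM (ratfun p q _)) normrX normr_nat.
  have [M' HM'] : exists M' : R[i], forall n,
      `|ratfun p q n.+1%:R * n.+1%:R ^+ 2| <= M'.
    apply: (@bounded_shift R[i] (fun n => ratfun p q n.+1%:R * n.+1%:R ^+ 2) N M%:C).
    move=> n; have := HM _ (HN n); rewrite nE.
    rewrite (_ : (n + N).+1%:R ^ (- 2) = (n + N).+1%:R ^- 2 :> R[i]) //.
    by rewrite normfV normrX normr_nat ler_pdivlMr // exprn_gt0.
  exists M' => n; have := HM' n.
  by rewrite nE ler_pdivlMr // exprn_gt0.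
have pf : @partial_fraction R[i] s (ratfun p q).
  have := partial_fractionZ (lead_coef (ratfun_den p q))^-1
    (partial_fractions s0 (ratfun_num p q)).
  case=> [P [L [sL fE]]]; exists P, L; split.
    by apply: sub_all sL => t; rewrite mem_undup.
  move=> z zs; have zs0 : z \notin s0 by rewrite -mem_undup.
  rewrite -(fE z zs0); have -> : \prod_(a <- s0) (z - a) =
      (\prod_(a <- s0) ('X - a%:P)).[z].
    by rewrite horner_prod; apply: eq_bigr => a _; rewrite hornerXsubC.
  by rewrite mulrCA -invfM -hornerZ -denE.
have [L [sL fE S0]] := partial_fraction_decay (@harmonic0C R) pf ns fM.
pose fterm (t : R[i] * R[i] * nat) z := - t.2.+1%:R * (z - t.1.2) ^- t.2.+2 * phi z
       - (z - t.1.2) ^- t.2.+1 * phi z ^+ 2.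
(* The limits are chosen for all pairs of a point and a term at once; off [s] the value 0 is a mere
   default. *)
have /choice[l Hl] : forall x : R[i] * (R[i] * R[i] * nat), exists l : R[i],
    x.1 \in s -> @res_is R[i] (fterm x.2) x.1 l /\
    ((if x.1 == x.2.1.2 then - square_coef x.1 N x.2.2 else 0 : (R[i] : numFieldType))
       @[N --> \oo] --> (l : (R[i] : numFieldType))).
  move=> [a t] /=; have [as_|] := boolP (a \in s); last by exists 0.
  have [|l Hl] := @residue_term R a t; last by exists l.
  by move=> n; apply: contraTneq as_ => <-; exact: ns.
set F := fun s : R[i] => _ - _ * _ ^+ 2.
have resE a : a \in s -> residue F a = \sum_(t <- L) t.1.1 * l (a, t).
  move=> as_; apply: residueE.
  have H := @res_is_sum R[i] _ L (fun t z => t.1.1 * fterm t z)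
    (fun t => t.1.1 * l (a, t)) a (fun t => res_isZ _ (Hl (a, t) as_).1).
  (* Only punctured neighbourhoods matter, so [z] may avoid all of [s], where R and its derivative
     are computed term by term. *)
  apply: res_is_eq H; near=> z.
  have zs : z \notin s by apply: (near (near_notin (K := R[i]) s a) z).
  rewrite /F (eval_terms_derive sL fE zs) (fE _ zs) /eval_terms !mulr_suml -sumrB.
  by apply: eq_bigr => t _; rewrite /fterm /phi mulrBr !mulrA.
have us : uniq s by exact: undup_uniq.
have Hcvg := @cvg_harmonic_sum R[i] (@harmonic_mean0C R) s L (fun n => ratfun p q n.+1%:R) M
  (fun a t => l (a, t)) us sL (fun n => fE _ (ns n)) fM S0
  (fun a t as_ => (Hl (a, t) as_).2).
have -> : \sum_(a \in poles p q) residue F a =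
    \sum_(a <- s) \sum_(t <- L) t.1.1 * l (a, t).
  by rewrite polesE -fsbig_seq //; exact: eq_big_seq resE.
rewrite -(cvg_shiftn 1).
have -> : [sequence \sum_(1 <= k < n + 1) ratfun p q k%:R * harmonic_number R[i] k]_n =
  (fun N => \sum_(n < N) ratfun p q n.+1%:R * harmonic_number R[i] n.+1).
  by apply/funext => n /=; rewrite addn1 big_add1 /= big_mkord.
exact: Hcvg.
Unshelve. all: by end_near. Qed.
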